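(* Let $f_1,\dots,f_m$ be analytic functions of $m$ real variables, $\vec x^*$ an equilibrium of the target system $dx_i/dt=f_i(\vec x)$, $i=1,\dots,m$, with Jacobian $\boldsymbol{J}_m(\vec x^* )$ having eigenvalues $\lambda_1,\dots,\lambda_m$, and consider the extended system for $\vec X_1,\dots,\vec X_m\in\mathbb{R}^N$ with standard decay functions $$\frac{d\vec X_i}{dt}=\boldsymbol{\Omega}_1\boldsymbol{F}_i(\vec X_1,\dots,\vec X_m)\vec 1-\alpha_i(\boldsymbol{I}_N-\boldsymbol{\Omega}_1)\vec X_i,\qquad i=1,\dots,m,\quad \alpha_i>0,$$ where $\boldsymbol{F}_i$ is obtained from $f_i$ by any of the standard commutative, mixed commutative or standard non-commutative maps. Irrespective of the chosen map, the Jacobian at the fixed point $\vec X_i^*=x_i^*\vec 1$ is $$\boldsymbol{J}(\{\vec X_i^*\})=(\boldsymbol{J}_m(\vec x^* )+\boldsymbol{D}^1_\alpha)\otimes\boldsymbol{\Omega}_1-\boldsymbol{D}^N_\alpha .$$ In the case $\alpha_i\equiv\alpha$, consider more generally, for an $N\times N$ projector $\boldsymbol{\Omega}$ with $k$ eigenvalues equal to $1$ and the remaining $N-k$ equal to $0$ ($k=1$ for $\boldsymbol{\Omega}=\boldsymbol{\Omega}_1$), the matrix $$\boldsymbol{J}(\{\vec X_i^*\})=(\boldsymbol{J}_m(\vec x^* )+\alpha\boldsymbol{I}_m)\otimes\boldsymbol{\Omega}-\alpha\boldsymbol{I}_{Nm}.$$ Its eigenvalues are $\lambda_i$, $1\le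 i\le m$, with multiplicity $k$, and $-\alpha$ with multiplicity $m(N-k)$. As a consequence, if $\lambda_i<0$ for all $i$, then a stable equilibrium of the target system is still stable in the extended system; if the equilibrium is unstable, or if at least some $i$ exist for which $\lambda_i>0$, then it becomes a saddle point for the extended system, being characterized by $m(N-k)$ negative eigenvalues and $mk$ positive eigenvalues. Thus $\{\vec X_i^*\}$ is - stable if $\vec x^*$ is stable, - a saddle point if $\vec x^*$ is a saddle point, - a saddle point if $\vec x^*$ is unstable.
   Context: $\boldsymbol{I}_q$ is the $q\times q$ identity; $\otimes$ is the Kronecker product (block $(i,j)$ of $A\otimes B$ is $a_{ij}B$); $\boldsymbol{D}^q_\alpha$ is the diagonal matrix with diagonal $\alpha_1$ ($q$ times), $\alpha_2$ ($q$ times), ..., $\alpha_m$ ($q$ times); a projector is a matrix with $\boldsymbol{\Omega}^2=\boldsymbol{\Omega}$; $\vec 1\in\mathbb{R}^N$ is the all-ones vector; $\boldsymbol{\Omega}_1$ is the $N\times N$ matrix with all entries $1/N$; for $\vec X_i=(X_{i,1},\dots,X_{i,N})$, $\boldsymbol{X}_i=\mathrm{diag}(X_{i,1},\dots,X_{i,N})$. The nature of an equilibrium (stable, unstable, saddle) is read off the signs of the eigenvalues of the Jacobian there; for $m=1$ the paper's convention is: stable if $f'(x^* )<0$, unstable if $f'(x^* )>0$, saddle if $f'(x^* )=0$. The Taylor expansion of $f_i$ is written $f_i(x_1,\dots,x_m)=\sum_{k\ge0}\sum_{j_1+\dots+j_m=k}a_{i,k;j_1,\dots,j_m}x_1^{j_1}\cdots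 x_m^{j_m}$, with constant term $a_{i,0}$. A matrix to the power zero is the identity. An ordering $S$ is a choice of coefficients $o_\sigma$, $\sigma$ ranging over the permutations of $\{1,\dots,m\}$, with $\sum_\sigma o_\sigma=1$; then $\{(\boldsymbol{\Omega}_1\boldsymbol{X}_1)^{j_1}\cdots(\boldsymbol{\Omega}_1\boldsymbol{X}_m)^{j_m}\}_S=\sum_{\sigma}o_\sigma(\boldsymbol{\Omega}_1\boldsymbol{X}_{\sigma(1)})^{j_{\sigma(1)}}\cdots(\boldsymbol{\Omega}_1\boldsymbol{X}_{\sigma(m)})^{j_{\sigma(m)}}$. Maps (inner sums over $j_1+\dots+j_m=k$): - standard commutative: $\boldsymbol{F}_i=\sum_{k\ge0}\sum a_{i,k;j_1,\dots,j_m}\boldsymbol{X}_1^{j_1}\cdots\boldsymbol{X}_m^{j_m}$; - mixed commutative: $\boldsymbol{F}_i=a_{i,0}\boldsymbol{I}_N+\sum_{k\ge1}\sum a_{i,k;j_1,\dots,j_m}\big(\boldsymbol{\Omega}_1(\boldsymbol{X}_1^{j_1}\cdots\boldsymbol{X}_m^{j_m})^{1/k}\big)^k$, powers of diagonal matrices being taken entrywise on the diagonal; - standard non-commutative: $\boldsymbol{F}_i=\sum_{k\ge0}\sum a_{i,k;j_1,\dots,j_m}\{(\boldsymbol{\Omega}_1\boldsymbol{X}_1)^{j_1}\cdots(\boldsymbol{\Omega}_1\boldsymbol{X}_m)^{j_m}\}_S$, for any ordering $S$.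
   Formalization: Mixed maps: monomials of degree ≥2 with total exponent exactly 1 in the zero coordinates of x* are excluded (no Jacobian there). Saddle claims need k>0, and k<N (N>1 for Ω_1) if unstable. If only some λ_i>0, the counts are m(N-k)+k#{λ_i<0} negative and k#{λ_i>0} positive. *)

(* Defs.v *)
From HB Require Import structures.
From mathcomp Require Export all_boot all_order all_algebra perm.
From mathcomp Require Export complex mxtens.
From mathcomp Require Export all_classical all_reals all_analysis.

Set Implicit Arguments.
Unset Strict Implicit.
Unset Printing Implicit Defensive.

Import Order.TTheory GRing.Theory Num.Theory.
Import numFieldNormedType.Exports.

Local Open Scope classical_set_scope.
Local Open Scope ring_scope.
Local Open Scope complex_scope.

(* The library's ['J f x] acts on row vectors, ['d f x u = u *m 'J f x]; its
   transpose has the partial derivative of [f_i] along [x_j] at entry (i, j). *)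
Definition Jac (R : realType) (p q : nat) (f : 'rV[R]_p -> 'rV[R]_q)
  (x : 'rV[R]_p) : 'M[R]_(q, p) := ('J f x)^T.

Definition multidx (m : nat) := {ffun 'I_m -> nat}.

Definition multideg (m : nat) (j : multidx m) : nat := (\sum_l j l)%N.

(* The sum of [F j] over all multi-indices with [j_1 + ... + j_m = k]; every
   entry of such a [j] is at most [k], which makes the range finite. *)
Definition homsum (V : nmodType) (m k : nat) (F : multidx m -> V) : V :=
  \sum_(j : {ffun 'I_m -> 'I_k.+1} |
          multideg [ffun l => nat_of_ord (j l)] == k)
    F [ffun l => nat_of_ord (j l)].

Definition monom (R : realType) (m : nat) (x : 'rV[R]_m) (j : multidx m) : R :=
  \prod_l x 0 l ^+ j l.

(* On the open polydisc of radii [r], [g] is the sum of its absolutely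
   convergent Taylor series at the origin, with coefficients [a]. *)
Definition taylor_on (R : realType) (m : nat) (r : 'I_m -> R)
  (g : 'rV[R]_m -> R) (a : multidx m -> R) : Prop :=
  forall y : 'rV[R]_m, (forall l, `|y 0 l| < r l) ->
    cvgn (series (fun k => homsum k (fun j => `|a j * monom y j|))) /\
    series (fun k => homsum k (fun j => a j * monom y j)) @ \oo --> g y.

Definition Omega1 (R : realType) (N : nat) : 'M[R]_N := const_mx N%:R^-1.

Definition Dmx (R : realType) (m q : nat) (alpha : 'rV[R]_m) : 'M[R]_(m * q) :=
  diag_mx (\row_s alpha 0 (mxtens_unindex s).1).

(* A state [v] of the extended system stacks X_1, ..., X_m, in the block order
   of the Kronecker product [*t]. *)
Definition block (R : realType) (m N : nat) (v : 'rV[R]_(m * N)) (i : 'I_m) :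
  'cV[R]_N := \col_p v 0 (mxtens_index (i, p)).

Definition blockdiag (R : realType) (m N : nat) (v : 'rV[R]_(m * N))
  (i : 'I_m) : 'M[R]_N := diag_mx (block v i)^T.

Definition uniform_state (R : realType) (m N : nat) (x : 'rV[R]_m) :
  'rV[R]_(m * N) := \row_s x 0 (mxtens_unindex s).1.

(* The real k-th root of [y] whenever there is one (nonnegative for even k);
   for [y < 0] and [k] even, the principal complex root. *)
Definition kroot (R : realType) (k : nat) (y : R) : R[i] :=
  if odd k && (y < 0) then - (k.-root (- y)%:C) else k.-root y%:C.

Inductive peds_map (R : realType) (m : nat) : Type :=
| StdCommutative
| MixedCommutative
| StdNonCommutative of {perm 'I_m} -> R.

Arguments StdCommutative {R m}.
Arguments MixedCommutative {R m}.

(* The matrix that replaces the monomial [x_1^{j_1} ... x_m^{j_m}].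
   In the mixed case the root of a negative entry may be complex; near a point
   [x^* \vec 1] without zero coordinates the roots on the diagonal all have the
   same phase, so that the k-th power is a real matrix and [Re] changes nothing.
   In degree 0 all three matrices are the identity, the last one because the
   coefficients of an ordering have sum 1. *)
Definition map_term (R : realType) (m N : nat) (M : peds_map R m)
  (v : 'rV[R]_(m * N)) (j : multidx m) : 'M[R]_N :=
  let X := blockdiag v in
  match M with
  | StdCommutative => \prod_(l < m) X l ^+ j l
  | MixedCommutative =>
      let D := \prod_(l < m) X l ^+ j l in
      let k := multideg j in
      map_mx (@complex.Re R)
        ((map_mx (real_complex R) (Omega1 R N)
            *m diag_mx (\row_p kroot k (D p p))) ^+ k)
  | StdNonCommutative o =>
      \sum_(s : {perm 'I_m})
        o s *: \prod_(l < m) (Omega1 R N *m X (s l)) ^+ j (s l)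
  end.

(* The matrix series is summed entrywise, by total degree. *)
Definition Fmx (R : realType) (m N : nat) (a : multidx m -> R)
  (M : peds_map R m) (v : 'rV[R]_(m * N)) : 'M[R]_N :=
  \matrix_(p, q) limn (series (fun k =>
    homsum k (fun j => a j * map_term M v j p q))).

Definition ext_field (R : realType) (m N : nat) (a : 'I_m -> multidx m -> R)
  (alpha : 'rV[R]_m) (M : 'I_m -> peds_map R m) (v : 'rV[R]_(m * N)) :
  'rV[R]_(m * N) :=
  \row_s let: (i, p) := mxtens_unindex s in
    (Omega1 R N *m Fmx (a i) (M i) v *m const_mx 1
       - alpha 0 i *: ((1%:M - Omega1 R N) *m block v i)) p 0.

(* An ordering has coefficients of sum 1.  The mixed map involves the roots
   [x_l^{j_l/k}], which are not differentiable at [x_l = 0]: if [k >= 2] and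
   the coordinates of [x] that vanish occur in a monomial with total exponent
   exactly 1, say [x_1 x_2] at [(0, 1)], the corresponding term behaves like
   [(\sum_p (X_{1,p})^{1/k})^k] and has no Jacobian at [x \vec 1] when
   [N >= 2].  Such monomials are excluded; there are none if no coordinate of
   [x] vanishes, nor if [m = 1]. *)
Definition admissible (R : realType) (m : nat) (M : peds_map R m)
  (a : multidx m -> R) (x : 'rV[R]_m) : Prop :=
  match M with
  | StdCommutative => True
  | MixedCommutative =>
      forall j, a j != 0 -> (2 <= multideg j)%N ->
        (\sum_(l < m | x 0%R l == 0%R) j l)%N != 1%N
  | StdNonCommutative o => \sum_(s : {perm 'I_m}) o s = 1
  end.

(* [s] lists the complex eigenvalues of [A] with their algebraic
   multiplicities. *)
Definition has_spectrum (R : realType) (n : nat) (A : 'M[R]_n) (s : seq R[i]) :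
  Prop :=
  char_poly (map_mx (real_complex R) A) = \prod_(z <- s) ('X - z%:P).

Definition eigenvalue_count (R : realType) (n : nat) (A : 'M[R]_n)
  (P : pred R[i]) (k : nat) : Prop :=
  exists2 s, has_spectrum A s & count P s = k.

Definition negRe (R : realType) : pred R[i] := fun z => complex.Re z < 0.
Definition posRe (R : realType) : pred R[i] := fun z => 0 < complex.Re z.

Definition stable_mx (R : realType) (n : nat) (A : 'M[R]_n) : Prop :=
  forall z : R[i], eigenvalue (map_mx (real_complex R) A) z -> negRe z.

Definition unstable_mx (R : realType) (n : nat) (A : 'M[R]_n) : Prop :=
  forall z : R[i], eigenvalue (map_mx (real_complex R) A) z -> posRe z.

(* All remaining cases, as for [m = 1], where [f'(x^* ) = 0] is a saddle. *)
Definition saddle_mx (R : realType) (n : nat) (A : 'M[R]_n) : Prop :=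
  ~ stable_mx A /\ ~ unstable_mx A.

Definition stable_eq (R : realType) (n : nat) (f : 'rV[R]_n -> 'rV[R]_n)
  (x : 'rV[R]_n) : Prop := f x = 0 /\ stable_mx (Jac f x).

Definition unstable_eq (R : realType) (n : nat) (f : 'rV[R]_n -> 'rV[R]_n)
  (x : 'rV[R]_n) : Prop := f x = 0 /\ unstable_mx (Jac f x).

Definition saddle_eq (R : realType) (n : nat) (f : 'rV[R]_n -> 'rV[R]_n)
  (x : 'rV[R]_n) : Prop := f x = 0 /\ saddle_mx (Jac f x).

(* Main.v *)
Require Import Defs.
From mathcomp Require Import lra ring.

(* The spectral part: over the complex numbers both factors of a Kronecker
   product can be triangularized, and the Kronecker product of two triangular
   matrices is triangular, so that the eigenvalues of [(A + c) *t B - c] are the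
   numbers [(u + c) * w - c] for eigenvalues [u] of [A] and [w] of [B].

   The analytic part: averaging over the [N] cells turns each of the three
   maps into a series [\sum_j a_j t_j], where [t_j] replaces the monomial
   [x^j]; [t_j] is the average of the monomials of the cells (standard
   commutative), the k-th power of the average of their k-th roots (mixed), or
   the monomial of the averages (non-commutative, since [\vec 1] is a common
   right eigenvector of the matrices [Omega1 *m X_l]).  In all cases the
   difference between [t_j] and the monomial of the averages is of second order
   at the uniform state, and it is Lipschitz there with constants that remain
   summable against [a_j].  Hence the averaged field equals [f] at the averaged
   state up to [o(h)]. *)

Set Implicit Arguments.
Unset Strict Implicit.
Unset Printing Implicit Defensive.

Import Order.TTheory GRing.Theory Num.Theory.
Import numFieldNormedType.Exports.

Local Open Scope classical_set_scope.
Local Open Scope ring_scope.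
Local Open Scope complex_scope.

(** * Spectra of Kronecker products *)

(** Scalar matrices commute with [P], so the intertwining relation extends to the characteristic
    matrices over the polynomials, where the nonzero factor [\det PX] can be cancelled. *)
Lemma char_poly_conj (F : fieldType) n (P A B : 'M[F]_n) :
  P \in unitmx -> P *m A = B *m P -> char_poly A = char_poly B.
Proof.
move=> uP PA; pose PX := map_mx (@polyC F) P.
have dPX : \det PX != 0.
  by rewrite det_map_mx polyC_eq0 -unitfE -unitmxE.
apply: (mulfI dPX); rewrite mulrC [RHS]mulrC /char_poly -[LHS]mulrC -!det_mulmx.
congr (\det _); rewrite /char_poly_mx mulmxBr mulmxBl -!map_mxM PA.
by rewrite scalar_mxC.
Qed.

Lemma exists_trig (C : numClosedFieldType) n (A : 'M[C]_n) :
  exists P T : 'M[C]_n, [/\ P \in unitmx, is_trig_mx T & P *m A = T *m P].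
Proof.
have [|P /unitarymx_unit uP /=] := @cotrigonalization C n [:: A].
  by move=> ? ? /[!inE] /eqP-> /eqP->.
rewrite andbT => tP; exists P, (conjmx P A); split=> //.
by rewrite conjumx// mulmxKV.
Qed.

Lemma tensmx11 (R : comNzRingType) m n :
  (1%:M : 'M[R]_m) *t (1%:M : 'M[R]_n) = 1%:M.
Proof.
apply/matrixP=> i j; case: (mxtens_indexP i) => i1 i2.
case: (mxtens_indexP j) => j1 j2; rewrite tensmxE !mxE -natrM mulnb.
by rewrite (can_eq (@mxtens_indexK m n)) xpair_eqE.
Qed.

(** Kronecker indices are ordered lexicographically: an entry above the diagonal has [i1 < j1],
    where [A] vanishes, or [i1 = j1] and [i2 < j2], where [B] vanishes. *)
Lemma tensmx_is_trig (R : comNzRingType) m n (A : 'M[R]_m) (B : 'M[R]_n) :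
  is_trig_mx A -> is_trig_mx B -> is_trig_mx (A *t B).
Proof.
move=> /is_trig_mxP tA /is_trig_mxP tB; apply/is_trig_mxP => i j.
case: (mxtens_indexP i) => i1 i2; case: (mxtens_indexP j) => j1 j2.
rewrite tensmxE /= => lt_ij; have [/tA->|ji] := ltnP i1 j1; first by rewrite mul0r.
move: lt_ij; move: ji; rewrite leq_eqVlt => /orP[/eqP ->|lt_ji].
  by rewrite ltn_add2l => /tB->; rewrite mulr0.
rewrite ltnNge => /negP[]; apply: leq_trans (leq_addr _ _).
apply: (@leq_trans (j1.+1 * n)); last by rewrite leq_mul2r lt_ji orbT.
by rewrite mulSn addnC leq_add2r ltnW.
Qed.

(** Conjugation by [P *t Q] makes the matrix triangular with diagonal entries
    [(T i i + c) * U j j - c]. By unique factorization the diagonals of [T] and [U] are [s] and [t]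
    up to order. *)
Lemma char_poly_tens_shift (C : numClosedFieldType) m n (A : 'M[C]_m)
    (B : 'M[C]_n) (s t : seq C) (c : C) :
  char_poly A = \prod_(z <- s) ('X - z%:P) ->
  char_poly B = \prod_(z <- t) ('X - z%:P) ->
  char_poly ((A + c%:M) *t B - c%:M) =
    \prod_(u <- s) \prod_(w <- t) ('X - ((u + c) * w - c)%:P).
Proof.
have [P [T [uP tT PA]]] := exists_trig A.
have [Q [U [uQ tU QB]]] := exists_trig B.
rewrite (char_poly_conj uP PA) (char_poly_conj uQ QB).
rewrite (char_poly_trig tT) (char_poly_trig tU).
rewrite -(big_map (fun i => T i i) xpredT (fun z => 'X - z%:P)).
rewrite -(big_map (fun i => U i i) xpredT (fun z => 'X - z%:P)).
move=> /prod_XsubC_eq Ts /prod_XsubC_eq Ut.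
have -> : char_poly ((A + c%:M) *t B - c%:M) =
          char_poly ((T + c%:M) *t U - c%:M).
  apply: (@char_poly_conj _ _ (P *t Q)).
    have : (P *t Q) *m (invmx P *t invmx Q) = 1%:M.
      by rewrite tensmx_mul !mulmxV// tensmx11.
    by case/mulmx1_unit.
  rewrite mulmxBr mulmxBl !tensmx_mul mulmxDr mulmxDl PA QB.
  by rewrite !scalar_mxC.
rewrite char_poly_trig; last first.
  have t1 : is_trig_mx (T + c%:M).
    apply/is_trig_mxP => i j ij; rewrite mxE (is_trig_mxP tT)// add0r.
    by rewrite (is_trig_mxP (scalar_mx_is_trig _ _)).
  apply/is_trig_mxP => i j ij.
  rewrite mxE (is_trig_mxP (tensmx_is_trig t1 tU))// add0r mxE.
  by rewrite (is_trig_mxP (scalar_mx_is_trig _ _))// oppr0.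
transitivity (\prod_i \prod_j ('X - ((T i i + c) * U j j - c)%:P)).
  rewrite pair_big /= (reindex (@mxtens_index m n)) /=; last first.
    by exists (@mxtens_unindex m n) => i _; rewrite ?mxtens_indexK ?mxtens_unindexK.
  by apply: eq_bigr => -[i j] _ /=; rewrite !mxE !mxtens_indexK /= !eqxx.
rewrite -(perm_big _ Ts) big_map; apply: eq_bigr => i _.
by rewrite -(perm_big _ Ut) big_map.
Qed.

(** * Complex spectra of real matrices, projectors and shifted Kronecker products *)

Section Spectrum.
Variable R : realType.
Local Notation C := R[i].

Lemma has_spectrumP n (A : 'M[R]_n) (s : seq C) z : has_spectrum A s ->
  eigenvalue (map_mx (real_complex R) A) z = (z \in s).
Proof. by move=> As; rewrite eigenvalue_root_char As root_prod_XsubC. Qed.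

Lemma has_spectrum_size n (A : 'M[R]_n) (s : seq C) :
  has_spectrum A s -> size s = n.
Proof.
move/(congr1 (fun p : {poly C} => size p)).
by rewrite size_char_poly size_prod_XsubC => -[].
Qed.

Lemma has_spectrum_mxtrace n (A : 'M[R]_n) (s : seq C) :
  has_spectrum A s -> (\tr A)%:C = \sum_(z <- s) z.
Proof.
move=> As; have [P [T [uP tT PA]]] := exists_trig (map_mx (real_complex R) A).
rewrite -[LHS]/(real_complex R (\tr A)) -trace_map_mx.
have -> : \tr (map_mx (real_complex R) A) = \tr T.
  by rewrite -[T](mulmxK uP) -PA mxtrace_mulC mulmxA mulVmx// mul1mx.
move: As; rewrite /has_spectrum (char_poly_conj uP PA) char_poly_trig//.
rewrite -(big_map (fun i => T i i) xpredT (fun z => 'X - z%:P)).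
by move=> /prod_XsubC_eq As; rewrite -(perm_big _ As) big_map.
Qed.

(* The eigenvalues of a projector are 0 and 1, and their sum is the trace. *)
Lemma projector_spectrum n (A : 'M[R]_n) k : A *m A = A -> \tr A = k%:R ->
  has_spectrum A (nseq k 1 ++ nseq (n - k) 0).
Proof.
move=> AA trA; set Ac := map_mx (real_complex R) A.
have [P [T [uP tT PA]]] := exists_trig Ac.
have sA : has_spectrum A [seq T i i | i : 'I_n].
  rewrite /has_spectrum -/Ac (char_poly_conj uP PA) char_poly_trig//.
  by rewrite big_map enumT.
(* Applying the idempotent matrix twice to an eigenvector gives [z * z = z]. *)
have s01 z : z \in [seq T i i | i : 'I_n] -> (z == 1) || (z == 0).
  rewrite -(has_spectrumP _ sA) => /eigenvalueP[v vA v0].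
  have : z *: (z *: v) = z *: v.
    by rewrite -{1}vA scalemxAl -[in LHS]vA -mulmxA -map_mxM AA.
  move/eqP; rewrite scalerA -subr_eq0 -scalerBl scaler_eq0 (negPf v0) orbF.
  rewrite -{3}[z]mulr1 -mulrBr mulf_eq0 subr_eq0 orbC.
  by case/orP => ->; rewrite ?orbT.
have ss := has_spectrum_size sA; have trs := has_spectrum_mxtrace sA.
move: ss trs sA s01.
move: [seq T i i | i : 'I_n] => s ss trs sA s01.
have sc : perm_eq s (nseq (count_mem 1 s) 1 ++ nseq (n - count_mem 1 s) 0).
  rewrite -ss; elim: s s01 {ss trs sA} => //= z s IH s01.
  have IHs : perm_eq s (nseq (count_mem 1 s) 1 ++ nseq (size s - count_mem 1 s) 0).
    by apply: IH => w ws; apply: s01; rewrite inE ws orbT.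
  have := s01 z; rewrite mem_head => /(_ isT)/orP[]/eqP ->.
    by rewrite eqxx /= add1n subSS perm_cons.
  rewrite eq_sym oner_eq0 add0n subSn ?count_size//=.
  by rewrite perm_sym -[_ :: nseq _ _]cat1s perm_catCA /= perm_cons perm_sym.
(* The number of ones is the trace, and characteristic zero allows the equality to be read in the
   natural numbers. *)
have ck : count_mem 1 s = k.
  move: trs; rewrite trA (perm_big _ sc) big_cat /= !big_nseq.
  rewrite !iter_addr_0 mul0rn addr0.
  rewrite -[LHS]/(real_complex R k%:R) rmorph_nat.
  by move=> /eqP; rewrite eqr_nat => /eqP.
rewrite /has_spectrum sA -ck; exact: perm_big.
Qed.

(** The value [(u + al) * w - al] is [u] for [w = 1] and [- al] for [w = 0]. *)
Lemma tens_shift_spectrum m n k (A : 'M[R]_m) (B : 'M[R]_n) (l : 'I_m -> C) al :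
  has_spectrum A [seq l i | i : 'I_m] ->
  has_spectrum B (nseq k 1 ++ nseq (n - k) 0) ->
  has_spectrum ((A + al%:M) *t B - al%:M)
    (flatten [seq nseq k (l i) | i : 'I_m] ++ nseq (m * (n - k)) (- al)%:C).
Proof.
move=> Al Bk; rewrite /has_spectrum map_mxB map_mxT map_mxD !map_scalar_mx.
rewrite (char_poly_tens_shift _ Al Bk) big_map big_enum /=.
under eq_bigr do rewrite big_cat /= !big_nseq !iter_mulr_1.
rewrite big_split /= big_cat /= big_flatten /=.
rewrite big_image big_nseq; congr (_ * _).
  by apply: eq_bigr => i _; rewrite big_nseq iter_mulr_1 mulr1 addrK.
under eq_bigr do rewrite mulr0 sub0r.
rewrite prodr_const card_ord iter_mulr_1 -exprM mulnC.
congr (('X - _%:P) ^+ _).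
by rewrite rmorphN.
Qed.


(** * Stability type and eigenvalue counts of the shifted Kronecker product *)

Section TensorProjector.
Variables (m n k : nat) (A : 'M[R]_m) (B : 'M[R]_n) (l : 'I_m -> C) (al : R).
Hypotheses (al_gt0 : 0 < al) (Al : has_spectrum A [seq l i | i : 'I_m])
  (Bk : has_spectrum B (nseq k 1 ++ nseq (n - k) 0)).
Let J := (A + al%:M) *t B - al%:M.

Lemma eigenvalue_tensP z :
  reflect ((0 < k)%N /\ eigenvalue (map_mx (real_complex R) A) z \/
           (0 < m * (n - k))%N /\ z = (- al)%:C)
    (eigenvalue (map_mx (real_complex R) J) z).
Proof.
rewrite (has_spectrumP _ (tens_shift_spectrum al Al Bk)) (has_spectrumP _ Al).
rewrite mem_cat mem_nseq; apply: (iffP orP) => -[].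
- move=> /flattenP[s /mapP[i _ ->]]; rewrite mem_nseq => /andP[k0 /eqP->].
  by left; split=> //; apply/mapP; exists i; rewrite ?mem_enum.
- by move=> /andP[? /eqP]; right.
- move=> [k0 /mapP[i _ ->]]; left; apply/flattenP; exists (nseq k (l i)).
    by apply/mapP; exists i; rewrite ?mem_enum.
  by rewrite mem_nseq k0 eqxx.
- by move=> [-> ->]; right; rewrite eqxx.
Qed.

Lemma negRe_opp : negRe (- al)%:C.
Proof. by rewrite /negRe /= oppr_lt0. Qed.

Lemma posRe_opp : ~~ posRe (- al)%:C.
Proof. by rewrite /posRe /= oppr_gt0 -leNgt ltW. Qed.

Lemma stable_tens : stable_mx A -> stable_mx J.
Proof.
by move=> stA z /eigenvalue_tensP[[_ /stA]//|[_ ->]]; exact: negRe_opp.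
Qed.

Lemma stable_tens_spectrum : (forall i, complex.Re (l i) < 0) -> stable_mx J.
Proof.
move=> l_lt0; apply: stable_tens => z.
by rewrite (has_spectrumP _ Al) => /mapP[i _ ->]; exact: l_lt0.
Qed.

(** For [0 < k] all eigenvalues of [A] persist in [J], so stability or instability of [J] would pass
    back to [A]. *)
Lemma saddle_tens : (0 < k)%N -> saddle_mx A -> saddle_mx J.
Proof.
move=> k0 [nst nun]; split => h; [apply: nst | apply: nun];
  by move=> z Az; apply: h; apply/eigenvalue_tensP; left.
Qed.

(** The eigenvalue [l i] rules out stability, and [- al], present because [k < n], rules out
    instability. *)
Lemma saddle_tens_pos : (0 < k < n)%N -> (exists i, 0 < complex.Re (l i)) ->
  saddle_mx J.
Proof.
move=> /andP[k0 kn] [i li]; split => h.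
  have /h : eigenvalue (map_mx (real_complex R) J) (l i).
    apply/eigenvalue_tensP; left; split=> //.
    by rewrite (has_spectrumP _ Al); apply/mapP; exists i; rewrite ?mem_enum.
  by rewrite /negRe ltNge ltW.
suff /h : eigenvalue (map_mx (real_complex R) J) (- al)%:C.
  by apply/negP; exact: posRe_opp.
apply/eigenvalue_tensP; right; split=> //.
by rewrite muln_gt0 subn_gt0 kn (leq_ltn_trans (leq0n _) (ltn_ord i)).
Qed.

Lemma saddle_tens_unstable : (0 < m)%N -> (0 < k < n)%N -> unstable_mx A ->
  saddle_mx J.
Proof.
move=> m0 kn unA; apply: saddle_tens_pos => //; exists (Ordinal m0).
apply: unA; rewrite (has_spectrumP _ Al); apply/mapP.
by exists (Ordinal m0); rewrite ?mem_enum.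
Qed.

Lemma count_tens (P : pred C) :
  eigenvalue_count J P
    (k * #|[pred i | P (l i)]| + P (- al)%:C * (m * (n - k))).
Proof.
eexists; first exact: (tens_shift_spectrum al Al Bk).
rewrite count_cat count_nseq; congr addn.
rewrite count_flatten -map_comp sumnE big_map big_enum /=.
under eq_bigr do rewrite count_nseq.
rewrite -big_distrl /= mulnC; congr muln.
rewrite -sum1_card [RHS]big_mkcond.
by apply: eq_bigr => i _; rewrite inE; case: (P _).
Qed.

Lemma count_negRe_tens :
  eigenvalue_count J (@negRe R)
    (m * (n - k) + k * #|[pred i | negRe (l i)]|).
Proof. by have := count_tens (@negRe R); rewrite negRe_opp mul1n addnC. Qed.

Lemma count_posRe_tens :
  eigenvalue_count J (@posRe R) (k * #|[pred i | posRe (l i)]|).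
Proof.
by have := count_tens (@posRe R); rewrite (negPf posRe_opp) mul0n addn0.
Qed.

Lemma count_tens_unstable : (forall i, 0 < complex.Re (l i)) ->
  eigenvalue_count J (@negRe R) (m * (n - k)) /\
  eigenvalue_count J (@posRe R) (m * k).
Proof.
move=> l_gt0; have cn := count_negRe_tens; have cp := count_posRe_tens.
have pE : #|[pred i | posRe (l i)]| = m.
  by rewrite -[RHS]card_ord; apply: eq_card => i; rewrite !inE /posRe l_gt0.
have nE : #|[pred i | negRe (l i)]| = 0%N.
  by apply: eq_card0 => i; rewrite !inE /negRe ltNge ltW.
by split; [rewrite nE muln0 addn0 in cn | rewrite pE [(k * m)%N]mulnC in cp].
Qed.

End TensorProjector.

Lemma Omega1_idem N : (0 < N)%N -> Omega1 R N *m Omega1 R N = Omega1 R N.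
Proof.
move=> N0; apply/matrixP => i j; rewrite !mxE.
under eq_bigr do rewrite !mxE.
rewrite sumr_const card_ord -[_ *+ N]mulr_natr mulfVK//.
by rewrite pnatr_eq0 -lt0n.
Qed.

Lemma Omega1_spectrum N : (0 < N)%N ->
  has_spectrum (Omega1 R N) (nseq 1 1 ++ nseq (N - 1) 0).
Proof.
move=> N0; apply: projector_spectrum; first exact: Omega1_idem.
rewrite /mxtrace; under eq_bigr do rewrite mxE.
by rewrite sumr_const card_ord -[_ *+ N]mulr_natr mulVf// pnatr_eq0 -lt0n.
Qed.

End Spectrum.

(** * First-order expansions *)

Section Littleo.
Variable R : realType.

Lemma dominated_series (u v : R^nat) :
  (forall k, `|u k| <= v k) -> cvgn (series v) -> cvgn (series u).
Proof.
move=> uv cv; apply: normed_cvg.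
apply: series_le_cvg cv => [k|k|//]; first exact: normr_ge0.
exact: le_trans (normr_ge0 _) (uv k).
Qed.

Lemma is_cvg_series_mull (c : R) (u : R^nat) :
  cvgn (series u) -> cvgn (series (fun k => c * u k)).
Proof. exact: is_cvg_seriesZ. Qed.

Lemma cvg_series_mull (c : R) (u : R^nat) l :
  series u @ \oo --> l -> series (fun k => c * u k) @ \oo --> c * l.
Proof.
move=> ul; have -> : series (fun k => c * u k) = (fun n => c * series u n).
  by apply/funext => n; rewrite /series /= mulr_sumr.
exact: cvgM (cvg_cst _) ul.
Qed.

Lemma cvg_series_sum (I : Type) (s : seq I) (F : I -> R^nat) (l : I -> R) :
  (forall i, series (F i) @ \oo --> l i) ->
  series (fun k => \sum_(i <- s) F i k) @ \oo --> \sum_(i <- s) l i.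
Proof.
move=> Fl; elim: s => [|i s IHs].
  rewrite big_nil; under eq_fun do rewrite big_nil.
  have -> : series (fun=> 0 : R) = fun=> 0 by apply/funext => n; exact: big1.
  exact: cvg_cst.
rewrite big_cons; under eq_fun do rewrite big_cons.
by rewrite [series _](seriesD (F i) (fun k => \sum_(i <- s) F i k)); exact: cvgD.
Qed.

(** The bound is also imposed at [h = 0], which forces [e 0 = 0]. *)
Definition littleo_at0 (V : normedModType R) (e : V -> R) : Prop :=
  forall eps, 0 < eps -> exists2 d, 0 < d &
    forall h, `|h| <= d -> `|e h| <= eps * `|h|.

Lemma littleo_at0D (V : normedModType R) (e1 e2 : V -> R) :
  littleo_at0 e1 -> littleo_at0 e2 -> littleo_at0 (fun h => e1 h + e2 h).
Proof.
move=> o1 o2 eps eps0; have eps20 : 0 < eps / 2 by rewrite divr_gt0.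
have [d1 d10 h1] := o1 _ eps20; have [d2 d20 h2] := o2 _ eps20.
exists (Num.min d1 d2); first by rewrite lt_min d10 d20.
move=> h; rewrite le_min => /andP[/h1 ? /h2 ?].
by rewrite (le_trans (ler_normD _ _))// [eps in leRHS]splitr mulrDl lerD.
Qed.

Lemma littleo_at0_comp (V W : normedModType R) (e : W -> R) (u : V -> W) :
  (forall h, `|u h| <= `|h|) -> littleo_at0 e -> littleo_at0 (fun h => e (u h)).
Proof.
move=> uh oe eps eps0; have [d d0 eh] := oe _ eps0; exists d => // h hd.
apply: le_trans (eh _ (le_trans (uh h) hd)) _.
by rewrite ler_wpM2l// ltW.
Qed.

(* Dominated differentiation: the tail is controlled by the Lipschitz bounds,
   the finitely many remaining terms by the quadratic bounds. *)
Lemma littleo_series (V : normedModType R) (E : nat -> V -> R) (L : R^nat)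
    (e : V -> R) (d : R) :
  0 < d -> (forall k, 0 <= L k) -> cvgn (series L) ->
  (forall k h, `|h| <= d -> `|E k h| <= L k * `|h|) ->
  (forall k, exists2 C, 0 <= C &
     forall h, `|h| <= d -> `|E k h| <= C * `|h| ^+ 2) ->
  (forall h, `|h| <= d -> series (E^~ h) @ \oo --> e h) ->
  littleo_at0 e.
Proof.
move=> d0 L0 cL EL EC Ee eps eps0.
have /choice[C0 /all_and2[C00 {}EC]] k : exists C, 0 <= C /\
    forall h, `|h| <= d -> `|E k h| <= C * `|h| ^+ 2.
  by have [C ? ?] := EC k; exists C.
have eps20 : 0 < eps / 2 by rewrite divr_gt0.
have [n Ln] : exists n, limn (series L) - series L n <= eps / 2.
  have /cvgrPdist_le/(_ _ eps20)[n _ nP] := cL.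
  by exists n; apply: le_trans (ler_norm _) (nP _ (leqnn n)).
have Lle k : series L k <= limn (series L).
  by apply: nondecreasing_cvgn_le => //; apply: nondecreasing_series.
pose C := \sum_(0 <= k < n) C0 k.
have C_ge0 : 0 <= C by apply: sumr_ge0.
(* This radius makes [C * |h|] at most [eps / 2], so that the first [n] terms use one half of [eps]
   and the tail the other; adding 1 avoids a division by zero. *)
exists (Num.min d (eps / 2 / (C + 1))).
  by rewrite lt_min d0 !divr_gt0// ltr_wpDl.
move=> h; rewrite le_min => /andP[hd]; rewrite ler_pdivlMr ?ltr_wpDl// => hC.
have Eh := Ee h hd.
rewrite -(cvg_lim _ (cvg_norm Eh))//; apply: limr_le.
  by apply/cvg_ex; eexists; exact: cvg_norm Eh.
near=> N; have nN : (n <= N)%N by near: N; exists n.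
rewrite /= (le_trans (ler_norm_sum _ _ _))//.
rewrite (@big_cat_nat _ _ _ n)//= [eps in leRHS]splitr mulrDl lerD//.
  apply: (@le_trans _ _ (C * `|h| ^+ 2)).
    by rewrite mulr_suml; apply: ler_sum => k _; exact: EC.
  rewrite expr2 mulrA ler_wpM2r// (le_trans _ hC)// mulrC ler_wpM2l//.
  by rewrite lerDl.
apply: (@le_trans _ _ ((series L N - series L n) * `|h|)).
  rewrite sub_series_geq// mulr_suml; apply: ler_sum => k _; exact: EL.
by rewrite ler_wpM2r// (le_trans _ Ln)// lerD2r.
Unshelve. all: by end_near. Qed.

Lemma ler_rV_norm n (h : 'rV[R]_n) i : `|h 0 i| <= `|h|.
Proof.
by rewrite [leRHS]mx_normrE (le_bigmax _ (fun ij => `|h ij.1 ij.2|) (0, i)).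
Qed.

Lemma rV_norm_le n (h : 'rV[R]_n) c :
  0 <= c -> (forall i, `|h 0 i| <= c) -> `|h| <= c.
Proof.
move=> c0 hc; rewrite [leLHS]mx_normrE; apply: bigmax_le => // -[i j] _ /=.
by rewrite ord1.
Qed.

Lemma continuous_mulmxr p q (A : 'M[R]_(p, q)) :
  continuous (mulmxr A : 'rV[R]_p -> 'rV[R]_q).
Proof.
pose K := \sum_i \sum_j `|A i j|.
have K0 : 0 <= K by apply: sumr_ge0 => i _; apply: sumr_ge0.
pose f : {linear 'rV[R]_p -> 'rV[R]_q} := mulmxr A.
apply/(linear_bounded_continuous f)/linear_boundedP.
exists (K + 1); split; first by rewrite realE addr_ge0.
move=> M KM; have M0 : 0 <= M by rewrite (le_trans _ (ltW KM))// addr_ge0.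
move=> h; apply: rV_norm_le => [|j]; first by rewrite mulr_ge0.
rewrite mxE (le_trans (ler_norm_sum _ _ _))//.
apply: (@le_trans _ _ (K * `|h|)); last first.
  by rewrite ler_wpM2r// (le_trans _ (ltW KM))// lerDl.
rewrite mulr_suml; apply: ler_sum => i _.
rewrite normrM mulrC ler_pM// ?ler_rV_norm//.
by rewrite (bigD1 j)//= lerDl sumr_ge0.
Qed.

(** The norm of a row vector is the maximum over its finitely many entries, so componentwise
    remainders suffice; uniqueness of the differential then identifies the Jacobian. *)
Lemma differentiable_rV p q (g : 'rV[R]_p -> 'rV[R]_q) x (A : 'M[R]_(p, q)) :
  (forall s, littleo_at0 (fun h => (g (x + h) - g x - h *m A) 0 s)) ->
  differentiable g x /\ Jac g x = A^T.
Proof.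
move=> gA; pose df : {linear 'rV[R]_p -> 'rV[R]_q} := mulmxr A.
have dg : g \o shift x = cst (g x) + df +o_ 0 id.
  apply/eqaddoP => eps eps0.
  have /choice[d dP] s : exists d, 0 < d /\ forall h, `|h| <= d ->
      `|(g (x + h) - g x - h *m A) 0 s| <= eps * `|h|.
    by have [d ? ?] := gA s _ eps0; exists d.
  near=> h; apply: rV_norm_le => [|s]; first by rewrite mulr_ge0// ltW.
  have -> : (g \o shift x - (cst (g x) + df)) h = g (x + h) - g x - h *m A.
    by rewrite !fctE /= opprD addrA [h + x]addrC.
  apply: (dP s).2; move: s.
  near: h; apply: filter_forall => s; have ds := (dP s).1.
  have : \forall h \near (0 : 'rV[R]_p), `|h| <= d s.
    by apply/nbhs_norm0P; exists (d s) => //= h /ltW.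
  exact.
have cdf : continuous df by exact: continuous_mulmxr.
have dE := diff_unique cdf dg; split.
  by apply/diff_locallyP; rewrite dE.
rewrite /Jac /jacobian; congr (_^T); apply/row_matrixP => i.
by rewrite !rowE mul_rV_lin1 /= dE.
Unshelve. all: by end_near. Qed.

End Littleo.

(** * Monomials and Taylor series *)

Section Homsum.
Variables (R : realType) (m : nat).
Implicit Types (F G : multidx m -> R).

Lemma ler_homsum k F G : (forall j, multideg j = k -> F j <= G j) ->
  homsum k F <= homsum k G.
Proof. by move=> FG; apply: ler_sum => j /eqP; exact: FG. Qed.

Lemma ler_norm_homsum k F : `|homsum k F| <= homsum k (fun j => `|F j|).
Proof. exact: ler_norm_sum. Qed.

Lemma homsum_ge0 k F : (forall j, 0 <= F j) -> 0 <= homsum k F.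
Proof. by move=> F0; apply: sumr_ge0. Qed.

Lemma eq_homsum k F G : (forall j, multideg j = k -> F j = G j) ->
  homsum k F = homsum k G.
Proof. by move=> FG; apply: eq_bigr => j /eqP; exact: FG. Qed.

Lemma homsumZ k (c : R) F : homsum k (fun j => c * F j) = c * homsum k F.
Proof. by rewrite [RHS]mulr_sumr. Qed.

Lemma homsumB k F G : homsum k (fun j => F j - G j) = homsum k F - homsum k G.
Proof. by rewrite /homsum sumrB. Qed.

Lemma homsum_sum (I : finType) k (F : I -> multidx m -> R) :
  homsum k (fun j => \sum_i F i j) = \sum_i homsum k (F i).
Proof. exact: exchange_big. Qed.

Lemma multideg_le (j : multidx m) l : (j l <= multideg j)%N.
Proof. by rewrite /multideg (bigD1 l)//= leq_addr. Qed.

Lemma homsum_quadratic (V : normedModType R) k (d : R) (F : multidx m -> V -> R) :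
  (forall j, exists2 C, 0 <= C &
     forall h, `|h| <= d -> `|F j h| <= C * `|h| ^+ 2) ->
  exists2 C, 0 <= C &
     forall h, `|h| <= d -> `|homsum k (F^~ h)| <= C * `|h| ^+ 2.
Proof.
move=> FC; have /choice[C /all_and2[C0 {}FC]] j : exists C, 0 <= C /\
    forall h, `|h| <= d -> `|F j h| <= C * `|h| ^+ 2.
  by have [C ? ?] := FC j; exists C.
exists (homsum k C) => [|h hd]; first exact: homsum_ge0.
rewrite (le_trans (ler_norm_homsum _ _))// mulrC -homsumZ.
by apply: ler_homsum => j _; rewrite mulrC; exact: FC.
Qed.

End Homsum.

(** * Uniform bounds for monomials on a ball around [x] *)

Section Monomials.
Variables (R : realType) (m : nat) (x : 'rV[R]_m) (eta : R).
Hypothesis eta_gt0 : 0 < eta.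

Definition radius : 'rV[R]_m := \row_l (`|x 0 l| + eta).
Local Notation rho := radius.

Lemma monom_ge0 (y : 'rV[R]_m) j : (forall l, 0 <= y 0 l) -> 0 <= monom y j.
Proof. by move=> y0; apply: prodr_ge0 => l _; apply: exprn_ge0. Qed.

Lemma radius_gt0 l : 0 < rho 0 l.
Proof. by rewrite mxE ltr_wpDl. Qed.

Lemma monom_radius_ge0 j : 0 <= monom rho j.
Proof. by apply: monom_ge0 => l; exact/ltW/radius_gt0. Qed.

(** A bound for the gradient on the ball: differentiating one of the [multideg j] factors replaces
    it by 1, which is at most [rho 0 l / eta]. *)
Definition monom_lipschitz (j : multidx m) : R :=
  (multideg j)%:R * monom rho j / eta.

Lemma monom_lipschitz_ge0 j : 0 <= monom_lipschitz j.
Proof. by rewrite !mulr_ge0// ?monom_radius_ge0// invr_ge0 ltW. Qed.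

(* [g] is bounded by [P] on the ball of radius [eta], [n * P / eta] bounds both
   its Lipschitz constant at 0 and its gradient there, and the first-order
   Taylor remainder is quadratic; bounds of this shape are multiplicative. *)
Definition tame (g : 'rV[R]_m -> R) (P n : R) : Prop :=
  [/\ 0 <= P, 0 <= n, forall u, `|u| <= eta -> `|g u| <= P,
      forall u, `|u| <= eta -> `|g u - g 0| <= n * P / eta * `|u| &
      exists c : 'cV[R]_m,
        (forall u : 'rV[R]_m, `|(u *m c) 0 0| <= n * P / eta * `|u|) /\
        exists2 C, 0 <= C & forall u, `|u| <= eta ->
          `|g u - g 0 - (u *m c) 0 0| <= C * `|u| ^+ 2].

Lemma tame1 : tame (fun=> 1) 1 0.
Proof.
split=> // [u _|u _|]; first by rewrite normr1.
  by rewrite subrr normr0 !mul0r.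
exists 0; split => [u|]; first by rewrite mulmx0 mxE normr0 !mul0r.
by exists 0 => // u _; rewrite subrr mulmx0 mxE subr0 normr0 mul0r.
Qed.

Lemma tame_coord l : tame (fun u => (x + u) 0 l) (rho 0 l) 1.
Proof.
have r1 u : `|u| <= 1 * rho 0 l / eta * `|u|.
  rewrite mul1r ler_peMl// ler_pdivlMr// mul1r mxE lerDr//.
have gE u : (x + u) 0 l - (x + 0) 0 l = u 0 l by rewrite addr0 mxE addrC addKr.
split=> // [|u ue|u ue|]; first exact/ltW/radius_gt0.
- rewrite !mxE (le_trans (ler_normD _ _))// lerD2l.
  exact: le_trans (ler_rV_norm _ _) ue.
- by rewrite gE (le_trans (ler_rV_norm _ _)).
exists (delta_mx l 0).
have cE (u : 'rV[R]_m) : (u *m (delta_mx l 0 : 'cV_m)) 0 0 = u 0 l.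
  by rewrite -colE mxE.
split=> [u|]; first by rewrite cE (le_trans (ler_rV_norm _ _)).
by exists 0 => // u _; rewrite gE cE subrr normr0 mul0r.
Qed.

(** The Leibniz rule: sup bounds multiply, while the gradient bounds relative to them, [n / eta] and
    [k / eta], add. *)
Lemma tameM g h P Q n k : tame g P n -> tame h Q k ->
  tame (fun u => g u * h u) (P * Q) (n + k).
Proof.
move=> [P0 n0 gP gL [c [cL [C C0 gC]]]] [Q0 k0 hQ hL [d [dL [D D0 hD]]]].
have e0 : `|0 : 'rV[R]_m| <= eta by rewrite normr0 ltW.
have LE u : (n + k) * (P * Q) / eta * `|u| =
    n * P / eta * `|u| * Q + P * (k * Q / eta * `|u|) by field; rewrite gt_eqF.
split; [exact: mulr_ge0|exact: addr_ge0| | |].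
- by move=> u ue; rewrite normrM ler_pM// ?gP ?hQ.
- move=> u ue; rewrite LE.
  have -> : g u * h u - g 0 * h 0 = (g u - g 0) * h u + g 0 * (h u - h 0) by ring.
  rewrite (le_trans (ler_normD _ _))// !normrM lerD// ler_pM// ?gL ?hL ?gP ?hQ//.
exists (g 0 *: d + h 0 *: c).
have cE (u : 'rV[R]_m) : (u *m (g 0 *: d + h 0 *: c)) 0 0 =
    g 0 * (u *m d) 0 0 + h 0 * (u *m c) 0 0 by rewrite mulmxDr -!scalemxAr !mxE.
split=> [u|].
  rewrite cE LE addrC (le_trans (ler_normD _ _))// !normrM mulrC.
  by rewrite lerD// ler_pM// ?cL ?dL ?gP ?hQ.
pose A := n * P / eta; pose B := k * Q / eta.
have A0 : 0 <= A by rewrite divr_ge0 ?mulr_ge0// ltW.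
have B0 : 0 <= B by rewrite divr_ge0 ?mulr_ge0// ltW.
(* The three summands bound the product of the two increments, and each function at 0 times the
   Taylor remainder of the other. *)
exists (A * B + P * D + Q * C); first by rewrite !addr_ge0// mulr_ge0.
move=> u ue; rewrite cE.
have -> : g u * h u - g 0 * h 0 - (g 0 * (u *m d) 0 0 + h 0 * (u *m c) 0 0) =
    (g u - g 0) * (h u - h 0) + g 0 * (h u - h 0 - (u *m d) 0 0)
    + h 0 * (g u - g 0 - (u *m c) 0 0) by ring.
rewrite [leRHS]mulrDl [in leRHS]mulrDl.
rewrite (le_trans (ler_normD _ _))// lerD//; last first.
  by rewrite normrM -mulrA ler_pM// ?hQ ?gC.
rewrite (le_trans (ler_normD _ _))// lerD//; last first.
  by rewrite normrM -mulrA ler_pM// ?gP ?hD.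
have -> : A * B * `|u| ^+ 2 = (A * `|u|) * (B * `|u|) by ring.
by rewrite normrM ler_pM// ?gL ?hL.
Qed.

Lemma tame_prod (I : eqType) (s : seq I) (g : I -> 'rV[R]_m -> R) (P n : I -> R) :
  (forall i, tame (g i) (P i) (n i)) ->
  tame (fun u => \prod_(i <- s) g i u) (\prod_(i <- s) P i) (\sum_(i <- s) n i).
Proof.
move=> gt; elim: s => [|i s IHs].
  rewrite !big_nil; under [X in tame X]eq_fun do rewrite big_nil; exact: tame1.
by rewrite !big_cons; under [X in tame X]eq_fun do rewrite big_cons; exact: tameM.
Qed.

Lemma tame_monom j :
  tame (fun u => monom (x + u) j) (monom rho j) (multideg j)%:R.
Proof.
rewrite /multideg natr_sum; apply: tame_prod => l.
(* A power is viewed as a product over a list of [j l] equal factors, each contributing 1 to the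
   degree. *)
have := @tame_prod _ (nseq (j l) tt) (fun=> fun u => (x + u) 0 l)
  (fun=> rho 0 l) (fun=> 1) (fun=> tame_coord l).
under [X in tame X]eq_fun do rewrite big_nseq iter_mulr_1.
by rewrite !big_nseq iter_mulr_1 iter_addr_0.
Qed.

Lemma monom_scale c (y : 'rV[R]_m) j :
  monom (c *: y) j = c ^+ multideg j * monom y j.
Proof.
rewrite /monom /multideg -prodrXr -big_split /=.
by apply: eq_bigr => l _; rewrite mxE exprMn.
Qed.

(** A form of Bernoulli's inequality; it absorbs the degree produced by differentiation into a
    dilation by [1 + eta]. *)
Lemma deg_le_exp n : n%:R <= eta^-1 * (1 + eta) ^+ n.
Proof.
rewrite ler_pdivlMl//; elim: n => [|n IHn]; first by rewrite mulr0.
rewrite -natr1 mulrDr mulr1 exprS mulrDl mul1r lerD//.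
by apply: ler_peMr (ltW eta_gt0) _; rewrite exprn_ege1// lerDl ltW.
Qed.

(** * Termwise differentiation of a Taylor series *)

Section Taylor.
Variables (r : 'I_m -> R) (g : 'rV[R]_m -> R) (a : multidx m -> R).
Hypothesis r_rho : forall l, (1 + eta) * rho 0 l < r l.
Hypothesis ga : taylor_on r g a.

(** The point [(1 + eta) *: rho] still lies in the polydisc; absolute convergence there leaves a
    spare factor [(1 + eta) ^+ multideg j], which dominates the degree. *)
Lemma cvg_lipschitz_series :
  cvgn (series (fun k => homsum k (fun j => `|a j| * monom_lipschitz j))).
Proof.
have y_r l : `|((1 + eta) *: rho) 0 l| < r l.
  have y0 : 0 <= ((1 + eta) *: rho) 0 l.
    by rewrite mxE mulr_ge0 ?(ltW (radius_gt0 _))// addr_ge0// ltW.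
  by rewrite ger0_norm// mxE.
have [cy _] := ga y_r.
have := is_cvg_series_mull (c := eta^-1 * eta^-1) cy; apply: dominated_series => k.
rewrite (le_trans (ler_norm_homsum _ _))//.
rewrite -homsumZ; apply: ler_homsum => j _.
rewrite normrM normr_id (ger0_norm (monom_lipschitz_ge0 j)) normrM.
rewrite monom_scale normrM (ger0_norm (monom_radius_ge0 j)).
have p0 : 0 <= (1 + eta) ^+ multideg j by rewrite exprn_ge0// addr_ge0// ltW.
have i0 : 0 <= eta^-1 by rewrite invr_ge0 ltW.
rewrite (ger0_norm p0) [leRHS]mulrCA ler_wpM2l//.
have -> : eta^-1 * eta^-1 * ((1 + eta) ^+ multideg j * monom rho j) =
  eta^-1 * (1 + eta) ^+ multideg j * monom rho j / eta by ring.
by rewrite ler_wpM2r// ler_wpM2r ?monom_radius_ge0// deg_le_exp.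
Qed.

Lemma near_radius (u : 'rV[R]_m) l : `|u| <= eta -> `|(x + u) 0 l| < r l.
Proof.
move=> ue; apply: le_lt_trans (r_rho l).
have [_ _ b _ _] := tame_coord l; apply: le_trans (b _ ue) _.
by rewrite ler_peMl ?(ltW (radius_gt0 _))// lerDl ltW.
Qed.

Lemma cvg_radius_series :
  cvgn (series (fun k => homsum k (fun j => `|a j| * monom rho j))).
Proof.
have y_r l : `|rho 0 l| < r l.
  rewrite gtr0_norm ?radius_gt0//; apply: le_lt_trans (r_rho l).
  by rewrite ler_peMl ?(ltW (radius_gt0 _))// lerDl ltW.
have [cy _] := ga y_r; apply: dominated_series cy => k.
rewrite (le_trans (ler_norm_homsum _ _))//; apply: ler_homsum => j _.
by rewrite normrM normr_id [in leRHS]normrM.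
Qed.

(** The coefficient is kept inside both bounds, so that a multi-index with [a j = 0] imposes no
    condition on [e j]. *)
Lemma littleo_homsum (V : normedModType R) (K : R) (e : multidx m -> V -> R)
    (E : V -> R) :
  0 <= K ->
  (forall j h, `|h| <= eta ->
     `|a j * e j h| <= K * (`|a j| * monom_lipschitz j) * `|h|) ->
  (forall j, exists2 C, 0 <= C &
     forall h, `|h| <= eta -> `|a j * e j h| <= C * `|h| ^+ 2) ->
  (forall h, `|h| <= eta ->
     series (fun k => homsum k (fun j => a j * e j h)) @ \oo --> E h) ->
  littleo_at0 E.
Proof.
move=> K0 eL eC eE.
apply: (@littleo_series _ _ (fun k h => homsum k (fun j => a j * e j h))
  (fun k => K * homsum k (fun j => `|a j| * monom_lipschitz j)) _ eta) => //.
- move=> k; rewrite mulr_ge0// homsum_ge0// => j.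
  by rewrite mulr_ge0 ?monom_lipschitz_ge0.
- exact: (is_cvg_series_mull (c := K) cvg_lipschitz_series).
- move=> k h he; rewrite (le_trans (ler_norm_homsum _ _))//.
  rewrite -homsumZ [leRHS]mulrC -homsumZ; apply: ler_homsum => j _.
  by rewrite [leRHS]mulrC; exact: eL.
- by move=> k; apply: homsum_quadratic.
Qed.

(** The gradient is the sum of the gradients of the monomials against [a]; the remainder is then the
    series of their first-order remainders. *)
Lemma taylor_differential :
  exists D : 'cV[R]_m,
    littleo_at0 (fun u => g (x + u) - g x - (u *m D) 0 0).
Proof.
have /choice[c /all_and2[cL cC]] j : exists c : 'cV[R]_m,
    (forall u : 'rV[R]_m, `|(u *m c) 0 0| <= monom_lipschitz j * `|u|) /\
    exists2 C, 0 <= C & forall u, `|u| <= eta ->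
      `|monom (x + u) j - monom (x + 0) j - (u *m c) 0 0| <= C * `|u| ^+ 2.
  by have [_ _ _ _ []] := tame_monom j => c ?; exists c.
pose ser l := fun k => homsum k (fun j => a j * c j l 0).
have cser l : cvgn (series (ser l)).
  apply: dominated_series cvg_lipschitz_series => k.
  rewrite (le_trans (ler_norm_homsum _ _))//; apply: ler_homsum => j _.
  (* Testing the gradient bound on a basis vector, of norm at most 1, bounds each coordinate of
     [c j]. *)
  rewrite normrM ler_wpM2l//; have := cL j (delta_mx 0 l).
  have -> : ((delta_mx 0 l : 'rV[R]_m) *m c j) 0 0 = c j l 0.
    by rewrite -rowE mxE.
  move=> lj; rewrite (le_trans lj)// ler_piMr ?monom_lipschitz_ge0//.
  apply: rV_norm_le => // i.
  by rewrite mxE normr_nat lern1 leq_b1.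
pose D : 'cV[R]_m := \col_l limn (series (ser l)); exists D.
apply: (@littleo_homsum _ 2
  (fun j u => monom (x + u) j - monom (x + 0) j - (u *m c j) 0 0)) => //.
- move=> j u ue; rewrite normrM.
  have [_ _ _ bL _] := tame_monom j.
  have -> : 2 * (`|a j| * monom_lipschitz j) * `|u| =
     `|a j| * (monom_lipschitz j * `|u| + monom_lipschitz j * `|u|) by ring.
  rewrite ler_wpM2l// (le_trans (ler_normB _ _))// lerD// ?cL//.
  exact: bL.
- move=> j; have [C C0 hC] := cC j; exists (`|a j| * C); first by rewrite mulr_ge0.
  by move=> u ue; rewrite normrM -mulrA ler_wpM2l// hC.
move=> u ue.
have [_ cu] := ga (fun l => near_radius l ue).
have e0 : `|0 : 'rV[R]_m| <= eta by rewrite normr0 ltW.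
have [_ c0] := ga (fun l => near_radius l e0).
rewrite -[in g x](addr0 x).
have -> : (u *m D) 0 0 = \sum_l u 0 l * limn (series (ser l)).
  by rewrite mxE; under eq_bigr do rewrite mxE.
have cD : series (fun k => homsum k (fun j => a j * (u *m c j) 0 0)) @ \oo -->
    \sum_l u 0 l * limn (series (ser l)).
  have -> : (fun k => homsum k (fun j => a j * (u *m c j) 0 0)) =
      (fun k => \sum_l u 0 l * ser l k).
    apply/funext => k; under [RHS]eq_bigr do rewrite -homsumZ.
    rewrite -homsum_sum; apply: eq_homsum => j _.
    by rewrite mxE mulr_sumr; apply: eq_bigr => l _; rewrite mulrCA.
  by apply: cvg_series_sum => l; exact: (@cvg_series_mull _ _ _ _ (cser l)).
have -> : (fun k => homsum k (fun j =>
      a j * (monom (x + u) j - monom (x + 0) j - (u *m c j) 0 0))) =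
    (fun k => homsum k (fun j => a j * monom (x + u) j))
    - (fun k => homsum k (fun j => a j * monom (x + 0) j))
    - (fun k => homsum k (fun j => a j * (u *m c j) 0 0)).
  apply/funext => k; rewrite !fctE -!homsumB.
  by apply: eq_homsum => j _; rewrite !mulrBr.
by rewrite !seriesD !seriesN; exact: cvgB (cvgB cu c0) cD.
Qed.

End Taylor.
End Monomials.

(** * Row sums, averages and real roots *)

Section RowBounded.
Variables (K : numDomainType) (n : nat).
Implicit Types A B : 'M[K]_n.

(** A bound on the operator norm for the sup norm, hence submultiplicative. The general [K] covers
    both the real matrices and the complex ones of the mixed map. *)
Definition row_bounded A (b : K) := forall p, (\sum_q `|A p q| <= b)%R.

Lemma row_bounded_entry A b p q : row_bounded A b -> (`|A p q| <= b).
Proof.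
by move=> /(_ p) Ab; apply: le_trans Ab; rewrite (bigD1 q)//= lerDl sumr_ge0.
Qed.

Lemma row_bounded1 : row_bounded (1%:M : 'M[K]_n) 1.
Proof.
move=> p; rewrite (bigD1 p)//= big1 => [|q /negPf qp].
  by rewrite mxE eqxx normr1 addr0.
by rewrite mxE eq_sym qp normr0.
Qed.

Lemma row_boundedM A B a b : 0 <= b -> row_bounded A a -> row_bounded B b ->
  row_bounded (A *m B) (a * b).
Proof.
move=> b0 Aa Bb p.
apply: (@le_trans _ _ (\sum_q \sum_s `|A p s| * `|B s q|)).
  apply: ler_sum => q _; rewrite mxE (le_trans (ler_norm_sum _ _ _))//.
  by apply: ler_sum => s _; rewrite normrM.
rewrite exchange_big /=; apply: (@le_trans _ _ (\sum_s `|A p s| * b)).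
  by apply: ler_sum => s _; rewrite -mulr_sumr ler_wpM2l.
by rewrite -mulr_suml ler_wpM2r.
Qed.

Lemma row_boundedX A a k : 0 <= a -> row_bounded A a ->
  row_bounded (A ^+ k) (a ^+ k).
Proof.
move=> a0 Aa; elim: k => [|k IHk]; first by rewrite !expr0; exact: row_bounded1.
by rewrite !exprS; apply: row_boundedM => //; exact: exprn_ge0.
Qed.

Lemma row_bounded_prod (I : Type) (s : seq I) (F : I -> 'M[K]_n) (b : I -> K) :
  (forall i, 0 <= b i) -> (forall i, row_bounded (F i) (b i)) ->
  row_bounded (\prod_(i <- s) F i) (\prod_(i <- s) b i).
Proof.
move=> b0 Fb; elim: s => [|i s IHs]; first by rewrite !big_nil; exact: row_bounded1.
by rewrite !big_cons; apply: row_boundedM => //; exact: prodr_ge0.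
Qed.

Lemma row_bounded_diag (d : 'rV[K]_n) b :
  (forall p, `|d 0 p| <= b) -> row_bounded (diag_mx d) b.
Proof.
move=> db p; rewrite (bigD1 p)//= big1 => [|q /negPf qp].
  by rewrite mxE eqxx mulr1n addr0.
by rewrite mxE eq_sym qp mulr0n normr0.
Qed.

End RowBounded.

Section Average.
Variables (R : realType) (N : nat).
Hypothesis N_gt0 : (0 < N)%N.

Definition avg (F : 'I_N -> R) : R := N%:R^-1 * \sum_p F p.

Lemma avg_cst c : avg (fun=> c) = c.
Proof.
by rewrite /avg sumr_const card_ord -[c *+ N]mulr_natl mulKf// pnatr_eq0 -lt0n.
Qed.

Lemma avgB F G : avg (fun p => F p - G p) = avg F - avg G.
Proof. by rewrite /avg sumrB mulrBr. Qed.

Lemma avgZ c F : avg (fun p => c * F p) = c * avg F.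
Proof. by rewrite /avg -mulr_sumr mulrCA. Qed.

Lemma ler_avg F G : (forall p, F p <= G p) -> avg F <= avg G.
Proof. by move=> FG; rewrite ler_wpM2l ?invr_ge0// ler_sum. Qed.

Lemma avg_ge0 F : (forall p, 0 <= F p) -> 0 <= avg F.
Proof. by move=> F0; rewrite mulr_ge0 ?invr_ge0// sumr_ge0. Qed.

Lemma ler_norm_avg F c : (forall p, `|F p| <= c) -> `|avg F| <= c.
Proof.
move=> Fc; rewrite ler_norml; apply/andP; split.
  by rewrite -[leLHS]avg_cst; apply: ler_avg => p;
    have := Fc p; rewrite ler_norml => /andP[].
by rewrite -[leRHS]avg_cst; apply: ler_avg => p;
  have := Fc p; rewrite ler_norml => /andP[].
Qed.

Lemma avg_between F : exists p q, F p <= avg F <= F q.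
Proof.
pose p0 := Ordinal N_gt0.
have [p _ Fp] := @arg_minP _ _ _ p0 xpredT F isT.
have [q _ Fq] := @arg_maxP _ _ _ p0 xpredT F isT.
exists p, q; apply/andP; split.
  by rewrite -[leLHS]avg_cst; apply: ler_avg => i; exact: Fp.
by rewrite -[leRHS]avg_cst; apply: ler_avg => i; exact: Fq.
Qed.

(** The average lies between two of the values, and powers are monotone on nonnegative numbers. *)
Lemma avg_expr_dist (g : 'I_N -> R) k (c : R) :
  (forall p, 0 <= g p) -> (forall p, `|g p ^+ k - 1| <= c) ->
  `|avg g ^+ k - 1| <= c.
Proof.
move=> g0 gc; have [p [q /andP[gp gq]]] := avg_between g.
have := gc p; have := gc q; rewrite !ler_norml => /andP[_ hq] /andP[hp _].
have a0 : 0 <= avg g by exact: avg_ge0.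
have h1 : g p ^+ k <= avg g ^+ k by apply: lerXn2r; rewrite ?nnegrE.
have h2 : avg g ^+ k <= g q ^+ k by apply: lerXn2r; rewrite ?nnegrE.
by apply/andP; split; lra.
Qed.

Lemma expr_tangent (B : R) k : 0 <= B -> exists2 C, 0 <= C &
  forall u, `|u - 1| <= B -> `|u ^+ k - 1 - k%:R * (u - 1)| <= C * (u - 1) ^+ 2.
Proof.
move=> B0; elim: k => [|k [C C0 IHk]].
  by exists 0 => // u _; rewrite expr0 subrr mul0r subrr normr0 mul0r.
exists ((1 + B) * C + k%:R) => [|u uB].
  by rewrite addr_ge0// mulr_ge0// addr_ge0.
have -> : u ^+ k.+1 - 1 - k.+1%:R * (u - 1) =
    u * (u ^+ k - 1 - k%:R * (u - 1)) + k%:R * (u - 1) ^+ 2.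
  by rewrite exprS -natr1; ring.
rewrite mulrDl (le_trans (ler_normD _ _))// lerD//.
  rewrite normrM -mulrA ler_pM ?IHk//.
  by rewrite -[u in leLHS](subrK 1) addrC (le_trans (ler_normD _ _))// normr1 lerD2l.
by rewrite ger0_norm// mulr_ge0// sqr_ge0.
Qed.

(** Both quantities have the first-order part [1 + k%:R * (avg g - 1)] at 1, so only the two tangent
    remainders are left. *)
Lemma avg_expr_quadratic (B : R) k : (0 < k)%N -> 0 <= B -> exists2 C, 0 <= C &
  forall (g : 'I_N -> R) c, c <= B -> (forall p, 0 <= g p) ->
    (forall p, `|g p ^+ k - 1| <= c) ->
    `|avg g ^+ k - avg (fun p => g p ^+ k)| <= C * c ^+ 2.
Proof.
move=> k0 B0; have [C C0 hC] := expr_tangent k B0.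
exists (C + C) => [|g c cB g0 gk]; first exact: addr_ge0.
have c0 : 0 <= c by apply: le_trans (gk (Ordinal N_gt0)).
(* In [g ^+ k - 1 = (g - 1) * (1 + g + ...)] the second factor is at least 1. *)
have g1 p : `|g p - 1| <= c.
  apply: le_trans (gk p); rewrite subrX1 normrM ler_peMr// ger0_norm; last first.
    by apply: sumr_ge0 => i _; exact: exprn_ge0.
  case: k k0 {hC gk} => // k _; rewrite big_ord_recl expr0 lerDl.
  by apply: sumr_ge0 => i _; exact: exprn_ge0.
have a1 : `|avg g - 1| <= c.
  by rewrite -[1]avg_cst -avgB; exact: ler_norm_avg.
have sq u : `|u - 1| <= c -> (u - 1) ^+ 2 <= c ^+ 2.
  by move=> uc; rewrite -real_normK ?num_real// lerXn2r ?nnegrE.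
have h1 : `|avg g ^+ k - 1 - k%:R * (avg g - 1)| <= C * c ^+ 2.
  by rewrite (le_trans (hC _ (le_trans a1 cB)))// ler_wpM2l// sq.
have h2 : `|avg (fun p => g p ^+ k - 1 - k%:R * (g p - 1))| <= C * c ^+ 2.
  apply: ler_norm_avg => p.
  by rewrite (le_trans (hC _ (le_trans (g1 p) cB)))// ler_wpM2l// sq.
have -> : avg g ^+ k - avg (fun p => g p ^+ k) =
    (avg g ^+ k - 1 - k%:R * (avg g - 1))
    - avg (fun p => g p ^+ k - 1 - k%:R * (g p - 1)).
  by rewrite !avgB avgZ avgB !avg_cst; ring.
by rewrite mulrDl (le_trans (ler_normB _ _))// lerD.
Qed.

End Average.

Section Kroot.
Variable R : realType.
Local Notation C := R[i].

Lemma krootK k (y : R) : (0 < k)%N -> kroot k y ^+ k = y%:C.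
Proof.
move=> k0; rewrite /kroot; case: ifP => [/andP[ko _]|_]; last by rewrite rootCK.
by rewrite exprNn rootCK// -signr_odd ko expr1 mulN1r rmorphN opprK.
Qed.

Lemma kroot1 (y : R) : kroot 1 y = y%:C.
Proof. by rewrite -[LHS]expr1 krootK. Qed.

Definition real_root k (y : R) : R := complex.Re (k.-root y%:C).

(** The principal root of a nonnegative number is nonnegative in the order of the complex numbers,
    which includes a zero imaginary part. *)
Lemma real_root_spec k (y : R) : (0 < k)%N -> 0 <= y ->
  [/\ 0 <= real_root k y, k.-root y%:C = (real_root k y)%:C &
      real_root k y ^+ k = y].
Proof.
move=> k0 y0; have w0 : 0 <= k.-root y%:C :> C by rewrite rootC_ge0// lecR.
have wE : k.-root y%:C = (real_root k y)%:C.
  rewrite /real_root; case: (k.-root _) w0 => a b; rewrite lecE /= => /andP[/eqP b0 _].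
  by rewrite b0.
split=> //; first by rewrite wE lecR in w0.
apply: (@complexI R); rewrite rmorphXn /= -[X in X ^+ k]/((real_root k y)%:C).
by rewrite -wE rootCK.
Qed.

Lemma normc_real (y : R) : `|y%:C| = `|y|%:C :> C.
Proof. by rewrite normc_def /= expr0n addr0 sqrtr_sqr. Qed.

Lemma normc_kroot k (y : R) : `|kroot k y| = k.-root `|y|%:C.
Proof.
have nE : k.-root `|y|%:C = `|k.-root y%:C| :> C by rewrite norm_rootC normc_real.
rewrite /kroot nE; case: ifP => // /andP[_ y0].
by rewrite normrN rmorphN !norm_rootC normrN.
Qed.

(** A positive factor leaves the sign test in [kroot] unchanged, so roots of numbers of equal sign
    share their phase. *)
Lemma krootM k (z q : R) : 0 < q ->
  kroot k (z * q) = k.-root q%:C * kroot k z.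
Proof.
move=> q0; have qC : 0 <= q%:C :> C by rewrite lecR ltW.
rewrite /kroot pmulr_llt0//; case: ifP => _.
  by rewrite -mulNr mulrC rmorphM rootCMl// mulrN.
by rewrite mulrC rmorphM rootCMl.
Qed.

Lemma normr_Re_le (z : C) (c : R) : `|z| <= c%:C -> `|complex.Re z| <= c.
Proof. by move=> zc; rewrite -lecR (le_trans (normc_ge_Re z)). Qed.

End Kroot.

(** * The matrix maps at a state of the extended system *)

Section RowSums.
Variables (K : pzRingType) (n : nat).
Implicit Types A B : 'M[K]_n.

(** This says that the all-ones column is a right eigenvector with eigenvalue [b]. *)
Definition row_sums A (b : K) := forall p, \sum_q A p q = b.

Lemma row_sums1 : row_sums 1%:M 1.
Proof.
move=> p; rewrite (bigD1 p)//= big1 => [|q /negPf qp].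
  by rewrite mxE eqxx addr0.
by rewrite mxE eq_sym qp.
Qed.

Lemma row_sumsM A B a b : row_sums A a -> row_sums B b ->
  row_sums (A *m B) (a * b).
Proof.
move=> Aa Bb p; under eq_bigr do rewrite mxE.
rewrite exchange_big /= -(Aa p) mulr_suml.
by apply: eq_bigr => s _; rewrite -mulr_sumr Bb.
Qed.

Lemma row_sumsX A a k : row_sums A a -> row_sums (A ^+ k) (a ^+ k).
Proof.
move=> Aa; elim: k => [|k IHk]; first by rewrite !expr0; exact: row_sums1.
by rewrite !exprS; exact: row_sumsM.
Qed.

Lemma row_sums_prod (I : Type) (s : seq I) (F : I -> 'M[K]_n) (b : I -> K) :
  (forall i, row_sums (F i) (b i)) ->
  row_sums (\prod_(i <- s) F i) (\prod_(i <- s) b i).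
Proof.
move=> Fb; elim: s => [|i s IHs]; first by rewrite !big_nil; exact: row_sums1.
by rewrite !big_cons; exact: row_sumsM.
Qed.

End RowSums.

Section ExtendedState.
Variables (R : realType) (m N : nat).
Hypothesis N_gt0 : (0 < N)%N.
Implicit Types (v h : 'rV[R]_(m * N)) (j : multidx m) (M : peds_map R m).

Definition cell v (p : 'I_N) : 'rV[R]_m := \row_l v 0 (mxtens_index (l, p)).

Definition mean_state v : 'rV[R]_m :=
  \row_l avg (fun p : 'I_N => v 0 (mxtens_index (l, p))).

Lemma cell_uniformD (x : 'rV[R]_m) h p :
  cell (uniform_state N x + h) p = x + cell h p.
Proof. by apply/rowP => l; rewrite !mxE mxtens_indexK. Qed.

Lemma mean_uniformD (x : 'rV[R]_m) h :
  mean_state (uniform_state N x + h) = x + mean_state h.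
Proof.
apply/rowP => l; rewrite !mxE -[x 0 l](avg_cst N_gt0) /avg -mulrDr -big_split /=.
by congr (_ * _); apply: eq_bigr => p _; rewrite !mxE mxtens_indexK.
Qed.

Lemma ler_norm_cell h p : `|cell h p| <= `|h|.
Proof. by apply: rV_norm_le => // l; rewrite mxE ler_rV_norm. Qed.

Lemma ler_norm_mean h : `|mean_state h| <= `|h|.
Proof.
by apply: rV_norm_le => // l; rewrite mxE ler_norm_avg// => p; rewrite ler_rV_norm.
Qed.

Lemma mean_state_mul h (c : 'cV[R]_m) :
  (mean_state h *m c) 0 0 = avg (fun p : 'I_N => (cell h p *m c) 0 0).
Proof.
rewrite mxE /avg; under [in RHS]eq_bigr do rewrite mxE.
rewrite exchange_big mulr_sumr; apply: eq_bigr => l _.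
rewrite mxE -mulrA mulr_suml; congr (_ * _).
by apply: eq_bigr => p _; rewrite mxE.
Qed.

Lemma diag_mxX (n : nat) (d : 'rV[R]_n) k :
  diag_mx d ^+ k = diag_mx (\row_p d 0 p ^+ k).
Proof.
elim: k => [|k IHk].
  rewrite expr0 -[LHS]/(1%:M) -diag_const_mx; congr diag_mx.
  by apply/rowP => p; rewrite !mxE.
rewrite exprS IHk [_ * _]mulmx_diag; congr diag_mx.
by apply/rowP => p; rewrite !mxE exprS.
Qed.

Lemma blockdiag_monom v j :
  \prod_(l < m) blockdiag v l ^+ j l = diag_mx (\row_p monom (cell v p) j).
Proof.
rewrite /monom; elim: (index_enum _) => [|l s IHs].
  rewrite big_nil -[LHS]/(1%:M) -diag_const_mx; congr diag_mx.
  by apply/rowP => p; rewrite !mxE big_nil.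
rewrite big_cons IHs diag_mxX [_ * _]mulmx_diag; congr diag_mx.
by apply/rowP => p; rewrite !mxE big_cons !mxE.
Qed.

Lemma monom_deg0 (y : 'rV[R]_m) j : multideg j = 0%N -> monom y j = 1.
Proof.
move=> j0; apply: big1 => l _; have := multideg_le j l.
by rewrite j0 leqn0 => /eqP ->; rewrite expr0.
Qed.

Lemma row_sums_diag (n : nat) (d : 'rV[R]_n) p :
  \sum_q diag_mx d p q = d 0 p.
Proof.
rewrite (bigD1 p)//= big1 => [|q /negPf qp]; first by rewrite mxE eqxx addr0.
by rewrite mxE eq_sym qp mulr0n.
Qed.

Lemma row_sums_Omega1_diag v l :
  row_sums (Omega1 R N *m blockdiag v l) (mean_state v 0 l).
Proof.
move=> p; rewrite mul_mx_diag; under eq_bigr do rewrite !mxE.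
by rewrite -mulr_sumr mxE.
Qed.

Lemma row_bounded_Omega1 : row_bounded (Omega1 R N) 1.
Proof.
move=> p; under eq_bigr do rewrite mxE ger0_norm ?invr_ge0//.
by rewrite sumr_const card_ord -[_ *+ N]mulr_natr mulVf// pnatr_eq0 -lt0n.
Qed.

Definition term_mean M v j : R := avg (fun p => \sum_q map_term M v j p q).

Lemma term_mean_std v j :
  term_mean StdCommutative v j = avg (fun p : 'I_N => monom (cell v p) j).
Proof.
rewrite /term_mean /map_term blockdiag_monom /avg; congr (_ * _).
by apply: eq_bigr => p _; rewrite row_sums_diag mxE.
Qed.

(** Every ordered product has the all-ones vector as eigenvector, with the same eigenvalue since
    scalars commute; the weights then add up to 1. *)
Lemma term_mean_noncomm (o : {perm 'I_m} -> R) v j :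
  \sum_s o s = 1 -> term_mean (StdNonCommutative o) v j = monom (mean_state v) j.
Proof.
move=> o1; rewrite -[RHS](avg_cst N_gt0) /term_mean; congr avg.
apply/funext => p /=; under eq_bigr do rewrite summxE.
rewrite exchange_big /= -[RHS]mul1r -o1 mulr_suml; apply: eq_bigr => s _.
under eq_bigr do rewrite mxE; rewrite -mulr_sumr; congr (_ * _).
rewrite /monom (reindex_inj (@perm_inj _ s)) /=.
by apply: row_sums_prod => l; apply: row_sumsX; exact: row_sums_Omega1_diag.
Qed.

(** All rows of the complex matrix have the same sum, so its power has the power of that sum as row
    sum; [Re] is additive. *)
Lemma term_mean_mixed v j :
  term_mean MixedCommutative v j =
  complex.Re ((\sum_p (N%:R^-1)%:C * kroot (multideg j) (monom (cell v p) j))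
    ^+ multideg j).
Proof.
rewrite -[RHS](avg_cst N_gt0) /term_mean; congr avg; apply/funext => p.
rewrite /map_term blockdiag_monom; under eq_bigr do rewrite mxE.
rewrite -[LHS](raddf_sum (@complex.Re R)); congr complex.Re.
apply: row_sumsX => {}p; rewrite mul_mx_diag.
by apply: eq_bigr => q _; rewrite !mxE eqxx.
Qed.

(** The coefficients of an ordering may be negative, so their absolute values can add up to more
    than 1. *)
Definition term_bound M : R :=
  if M is StdNonCommutative o then \sum_s `|o s| else 1.

Lemma ler_monom (y z : 'rV[R]_m) j : (forall l, `|y 0 l| <= z 0 l) ->
  `|monom y j| <= monom z j.
Proof.
move=> yz; rewrite normr_prod; apply: ler_prod => l _.
by rewrite normr_ge0 normrX lerXn2r ?nnegrE// (le_trans _ (yz l)).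
Qed.

Lemma ler_norm_map_term M v j (z : 'rV[R]_m) p q :
  (forall l p, `|v 0 (mxtens_index (l, p))| <= z 0 l) ->
  `|map_term M v j p q| <= term_bound M * monom z j.
Proof.
move=> vz; have z0 l : 0 <= z 0 l by apply: le_trans (vz l p).
have bX l : row_bounded (blockdiag v l) (z 0 l).
  by apply: row_bounded_diag => r; rewrite !mxE.
case: M => [||o].
- rewrite mul1r; apply: row_bounded_entry; apply: row_bounded_prod => l.
    exact: exprn_ge0.
  exact: row_boundedX.
- rewrite mul1r /map_term mxE; apply: normr_Re_le; rewrite blockdiag_monom.
  set k := multideg j.
  have [k0|k_gt0] := posnP k.
    rewrite k0 expr0 monom_deg0//; apply: row_bounded_entry.
    exact: row_bounded1.
  (* With the bound written as a [k]-th power, it is enough to bound the root matrix before taking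
     powers. *)
  rewrite -[(monom z j)%:C](rootCK k_gt0).
  apply: row_bounded_entry; apply: row_boundedX.
    by rewrite rootC_ge0// lecR monom_ge0.
  rewrite -[k.-root _]mul1r; apply: row_boundedM.
  + by rewrite rootC_ge0// lecR monom_ge0.
  + move=> r; under eq_bigr do rewrite mxE normc_real.
    by rewrite -(raddf_sum (real_complex R)) lecR row_bounded_Omega1.
  apply: row_bounded_diag => r; rewrite !mxE eqxx mulr1n normc_kroot.
  rewrite ler_rootC ?nnegrE ?lecR ?monom_ge0//.
  by apply: ler_monom => l; rewrite mxE.
rewrite /map_term summxE (le_trans (ler_norm_sum _ _ _))// mulr_suml.
apply: ler_sum => s _; rewrite mxE normrM ler_wpM2l//.
rewrite /monom (reindex_inj (@perm_inj _ s)) /=.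
apply: row_bounded_entry; apply: row_bounded_prod => l; first exact: exprn_ge0.
apply: row_boundedX => //; rewrite -[z _ _]mul1r.
by apply: row_boundedM => //; exact: row_bounded_Omega1.
Qed.

Lemma Omega1_mean (A : 'M[R]_N) p :
  (Omega1 R N *m A *m const_mx 1) p (0 : 'I_1) = avg (fun p => \sum_q A p q).
Proof.
rewrite -mulmxA mxE /avg mulr_sumr; apply: eq_bigr => r _; rewrite !mxE.
by congr (_ * _); apply: eq_bigr => q _; rewrite mxE mulr1.
Qed.

(** Domination makes each entry series converge, so the [limn] in [Fmx] is a true limit; the average
    is a finite combination of these limits. *)
Lemma cvg_term_mean (a : multidx m -> R) M v (z : 'rV[R]_m) :
  cvgn (series (fun k => homsum k (fun j => `|a j| * monom z j))) ->
  (forall l p, `|v 0 (mxtens_index (l, p))| <= z 0 l) ->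
  series (fun k => homsum k (fun j => a j * term_mean M v j)) @ \oo -->
    avg (fun p => \sum_q Fmx a M v p q).
Proof.
move=> az vz.
have cF p q : series (fun k => homsum k (fun j => a j * map_term M v j p q))
    @ \oo --> Fmx a M v p q.
  rewrite mxE; apply: dominated_series (is_cvg_series_mull (c := term_bound M) az).
  move=> k; rewrite (le_trans (ler_norm_homsum _ _))// -homsumZ.
  apply: ler_homsum => j _; rewrite normrM mulrCA ler_wpM2l//.
  exact: ler_norm_map_term.
have cFp p := @cvg_series_sum _ _ (index_enum _) _ _ (cF p).
have cS := @cvg_series_mull _ N%:R^-1 _ _
  (@cvg_series_sum _ _ (index_enum _) _ _ cFp).
have -> : (fun k => homsum k (fun j => a j * term_mean M v j)) =
    (fun k => N%:R^-1 * \sum_p \sum_q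
       homsum k (fun j => a j * map_term M v j p q)); last exact: cS.
apply/funext => k; under [in RHS]eq_bigr do rewrite -homsum_sum.
rewrite -homsum_sum -homsumZ; apply: eq_homsum => j _.
rewrite /term_mean /avg mulrCA; congr (_ * _); rewrite mulr_sumr.
by apply: eq_bigr => p _; rewrite mulr_sumr.
Qed.

End ExtendedState.

(** * The mixed mean and estimates near the uniform state *)

Section MixedMean.
Variables (R : realType) (N : nat).
Hypothesis N_gt0 : (0 < N)%N.

Definition mixed_mean k (q : 'I_N -> R) : R :=
  complex.Re ((\sum_p (N%:R^-1)%:C * kroot k (q p)) ^+ k).

(** All [q p] have the sign of [z], so the possibly complex root of [z] factors out of the sum and
    its [k]-th power is the real number [z]. *)
Lemma mixed_meanE k (z : R) q : (0 < k)%N -> z != 0 ->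
  (forall p, 0 < q p / z) ->
  mixed_mean k q = z * avg (fun p => real_root k (q p / z)) ^+ k.
Proof.
move=> k0 z0 qz; rewrite /mixed_mean.
have -> : \sum_p (N%:R^-1)%:C * kroot k (q p) =
    (avg (fun p => real_root k (q p / z)))%:C * kroot k z.
  rewrite /avg mulr_sumr -[X in X * kroot k z]/(real_complex R _) rmorph_sum.
  rewrite mulr_suml; apply: eq_bigr => p _; rewrite rmorphM -mulrA; congr (_ * _).
  rewrite -[in LHS](divfK z0 (q p)) mulrC krootM//.
  by have [_ -> _] := real_root_spec k0 (ltW (qz p)).
by rewrite exprMn krootK// -!rmorphXn -rmorphM /= mulrC.
Qed.

Lemma ler_norm_mixed_mean k q (c : R) : (0 < k)%N ->
  (forall p, `|q p| <= c) -> `|mixed_mean k q| <= c.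
Proof.
move=> k0 qc; apply: normr_Re_le; pose g p := real_root k `|q p|.
have gP p := real_root_spec k0 (normr_ge0 (q p)).
have g0 p : 0 <= g p by have [] := gP p.
have [_ [p /andP[_ gp]]] := avg_between N_gt0 g.
have a0 : 0 <= avg g by exact: avg_ge0.
have gc : avg g ^+ k <= c.
  apply: le_trans (qc p); have [_ _ <-] := gP p.
  by apply: lerXn2r; rewrite ?nnegrE ?a0 ?g0.
apply: (@le_trans _ _ ((avg g)%:C ^+ k)); last by rewrite -rmorphXn lecR.
rewrite normrX; apply: lerXn2r; rewrite ?nnegrE//; first by rewrite lecR.
rewrite (le_trans (ler_norm_sum _ _ _))// /avg mulr_sumr.
rewrite -[leRHS]/(real_complex R _) rmorph_sum; apply: ler_sum => r _ /=.
rewrite normrM normc_real normc_kroot ger0_norm ?invr_ge0//.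
by have [_ -> _] := gP r; rewrite rmorphM.
Qed.

Lemma mixed_mean_dist k (z : R) q c : (0 < k)%N ->
  (z != 0 -> forall p, 0 < q p / z) ->
  (forall p, `|q p - z| <= c) -> `|mixed_mean k q - z| <= c.
Proof.
(* At [z = 0] the roots need not share a phase, but the bound on the modulus suffices. *)
move=> k0 qz qc; have [z0|z0] := eqVneq z 0.
  rewrite z0 subr0; apply: ler_norm_mixed_mean => // p.
  by have := qc p; rewrite z0 subr0.
rewrite (mixed_meanE k0 z0 (qz z0)) -[X in _ - X]mulr1 -mulrBr normrM.
rewrite -ler_pdivlMl ?normr_gt0//; apply: avg_expr_dist => // p.
  by have [] := real_root_spec k0 (ltW (qz z0 p)).
have [_ _ ->] := real_root_spec k0 (ltW (qz z0 p)).
rewrite ler_pdivlMl ?normr_gt0// -normrM mulrBr mulr1 mulrCA mulfV// mulr1.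
exact: qc.
Qed.

Lemma mixed_mean_quadratic k (z B : R) : (0 < k)%N -> z != 0 -> 0 <= B ->
  exists2 C, 0 <= C & forall q c, c <= B ->
    (forall p, 0 < q p / z) -> (forall p, `|q p - z| <= c) ->
    `|mixed_mean k q - avg q| <= C * c ^+ 2.
Proof.
move=> k0 z0 B0; have z_gt0 : 0 < `|z| by rewrite normr_gt0.
have Bz : 0 <= B / `|z| by rewrite divr_ge0.
have [C C0 hC] := @avg_expr_quadratic _ _ N_gt0 (B / `|z|) k k0 Bz.
(* The relative deviations are at most [c / |z|]; squaring and multiplying back by [|z|] leaves one
   factor [1 / |z|]. *)
exists (C / `|z|) => [|q c cB qz qc]; first by rewrite divr_ge0.
rewrite (mixed_meanE k0 z0 qz).
have gP p := real_root_spec k0 (ltW (qz p)).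
have -> : avg q = z * avg (fun p => real_root k (q p / z) ^+ k).
  rewrite -avgZ; congr avg; apply/funext => p.
  by have [_ _ ->] := gP p; rewrite mulrCA mulfV// mulr1.
rewrite -mulrBr normrM -ler_pdivlMl//.
have -> : `|z|^-1 * (C / `|z| * c ^+ 2) = C * (c / `|z|) ^+ 2.
  by rewrite expr_div_n; field; rewrite gt_eqF.
apply: hC => [|p|p]; first by rewrite ler_wpM2r// invr_ge0.
  by have [] := gP p.
have [_ _ ->] := gP p; rewrite ler_pdivlMr// mulrC -normrM mulrBr mulr1.
by rewrite mulrCA mulfV// mulr1.
Qed.

End MixedMean.

Section Estimates.
Variables (R : realType) (m N : nat) (x : 'rV[R]_m) (eta : R).
Hypotheses (N_gt0 : (0 < N)%N) (eta_gt0 : 0 < eta) (eta_le1 : eta <= 1)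
  (eta_x : forall l, x 0 l != 0 -> eta < `|x 0 l|).
Implicit Types (h : 'rV[R]_(m * N)) (u : 'rV[R]_m) (j : multidx m).
Local Notation X := (uniform_state N x).
Local Notation Lip := (monom_lipschitz x eta).

Lemma monom_dist u j : `|u| <= eta ->
  `|monom (x + u) j - monom x j| <= Lip j * `|u|.
Proof.
by have [_ _ _ + _] := tame_monom x eta_gt0 j => /(_ u); rewrite addr0.
Qed.

Lemma ler_lip h u j : `|u| <= `|h| -> Lip j * `|u| <= Lip j * `|h|.
Proof. by move=> uh; rewrite ler_wpM2l// monom_lipschitz_ge0. Qed.

Lemma cell_dist h j p : `|h| <= eta ->
  `|monom (cell (X + h) p) j - monom x j| <= Lip j * `|h|.
Proof.
move=> he; have ch := ler_norm_cell h p; rewrite cell_uniformD.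
by rewrite (le_trans (monom_dist _ (le_trans ch he)))// ler_lip.
Qed.

Lemma mean_dist h j : `|h| <= eta ->
  `|monom (mean_state (X + h)) j - monom x j| <= Lip j * `|h|.
Proof.
move=> he; have mh := ler_norm_mean N_gt0 h; rewrite mean_uniformD//.
by rewrite (le_trans (monom_dist _ (le_trans mh he)))// ler_lip.
Qed.

(** The linear part at the mean state is the average of the linear parts at the cells, so the
    first-order terms cancel. *)
Lemma avg_monom_quadratic j : exists2 C, 0 <= C & forall h, `|h| <= eta ->
  `|avg (fun p : 'I_N => monom (cell (X + h) p) j) - monom (mean_state (X + h)) j|
    <= C * `|h| ^+ 2.
Proof.
have [_ _ _ _ [c [_ [C C0 hC]]]] := tame_monom x eta_gt0 j.
exists (C + C) => [|h he]; first exact: addr_ge0.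
have mh := ler_norm_mean N_gt0 h.
have sq (u : 'rV[R]_m) : `|u| <= `|h| -> C * `|u| ^+ 2 <= C * `|h| ^+ 2.
  by move=> uh; rewrite ler_wpM2l// lerXn2r ?nnegrE.
pose e u := monom (x + u) j - monom x j - (u *m c) 0 0.
have eC u : `|u| <= `|h| -> `|e u| <= C * `|h| ^+ 2.
  move=> uh; apply: le_trans (sq _ uh).
  by have := hC _ (le_trans uh he); rewrite addr0.
have -> : avg (fun p : 'I_N => monom (cell (X + h) p) j)
      - monom (mean_state (X + h)) j =
    avg (fun p : 'I_N => e (cell h p)) - e (mean_state h).
  rewrite /e !avgB avg_cst// -mean_state_mul mean_uniformD//.
  by under eq_fun do rewrite cell_uniformD; ring.
rewrite mulrDl (le_trans (ler_normB _ _))// lerD ?eC//.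
by apply: ler_norm_avg => // p; apply: eC; exact: ler_norm_cell.
Qed.

(** Coordinates with [x 0 l = 0] have exponent 0; the others satisfy [|u 0 l| < |x 0 l|] and keep
    their sign. *)
Lemma monom_ratio_gt0 u j : monom x j != 0 -> `|u| <= eta ->
  0 < monom (x + u) j / monom x j.
Proof.
move=> xj ue; rewrite /monom -prodf_div; apply: prodr_gt0 => l _.
have xl : x 0 l ^+ j l != 0.
  by apply: contraNneq xj => xl0; rewrite /monom (bigD1 l)//= xl0 mul0r.
rewrite -expr_div_n; have [->//|j0] := eqVneq (j l) 0%N.
apply: exprn_gt0; have x0 : x 0 l != 0 by rewrite expf_eq0 lt0n j0 in xl.
have ul : `|u 0 l| < `|x 0 l|.
  by rewrite (le_lt_trans (ler_rV_norm u l))// (le_lt_trans ue)// eta_x.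
rewrite mxE mulrDl divff// -ltrBlDl sub0r.
have : `|u 0 l / x 0 l| < 1 by rewrite normrM normfV ltr_pdivrMr ?normr_gt0// mul1r.
by rewrite ltr_norml => /andP[].
Qed.

(** Each factor from a vanishing coordinate is at most [|u|], and as [|u| <= 1] the total exponent
    may be lowered to 2. *)
Lemma monom_vanishing_quadratic j :
  (2 <= \sum_(l < m | x 0%R l == 0%R) j l)%N ->
  exists2 C, 0 <= C & forall u, `|u| <= eta -> `|monom (x + u) j| <= C * `|u| ^+ 2.
Proof.
move=> j2; pose rho := radius x eta.
exists (\prod_(l < m | x 0 l != 0) rho 0 l ^+ j l).
  by apply: prodr_ge0 => l _; rewrite exprn_ge0// ltW// radius_gt0.
move=> u ue; rewrite /monom normr_prod (bigID (fun l => x 0 l == 0)) /= mulrC.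
have u1 : `|u| <= 1 by exact: le_trans ue eta_le1.
apply: ler_pM; rewrite ?prodr_ge0//.
  apply: ler_prod => l _; rewrite normr_ge0 normrX lerXn2r ?nnegrE//.
    by rewrite ltW// radius_gt0.
  by have [_ _ b _ _] := tame_coord x eta_gt0 l; exact: b.
apply: (@le_trans _ _ (`|u| ^+ \sum_(l < m | x 0%R l == 0%R) j l)).
  rewrite -prodrXr; apply: ler_prod => l /eqP xl.
  by rewrite normr_ge0 normrX lerXn2r ?nnegrE// mxE xl add0r ler_rV_norm.
by rewrite ler_wiXn2l.
Qed.

Lemma term_mean_mixedE h j : term_mean MixedCommutative (X + h) j =
  mixed_mean (multideg j) (fun p : 'I_N => monom (cell (X + h) p) j).
Proof. exact: term_mean_mixed. Qed.

Lemma mixed_deg0 h j : multideg j = 0%N ->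
  term_mean MixedCommutative (X + h) j = monom (mean_state (X + h)) j.
Proof. by move=> j0; rewrite term_mean_mixedE /mixed_mean j0 expr0 monom_deg0. Qed.

Lemma term_mean_dist (M : peds_map R m) (a : multidx m -> R) h j :
  admissible M a x -> `|h| <= eta ->
  `|term_mean M (X + h) j - monom (mean_state (X + h)) j| <= 2 * Lip j * `|h|.
Proof.
have L0 : 0 <= Lip j * `|h| by rewrite mulr_ge0// monom_lipschitz_ge0.
(* Equality settles the non-commutative map and the mixed map in degree 0; otherwise both terms are
   compared with [monom x j], whence the constant 2. *)
move=> adm he; have [t0|t0] := eqVneq (term_mean M (X + h) j)
  (monom (mean_state (X + h)) j).
  by rewrite t0 subrr normr0 -mulrA mulr_ge0.
suff tx : `|term_mean M (X + h) j - monom x j| <= Lip j * `|h|.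
  rewrite -(subrKA (monom x j)) (le_trans (ler_normD _ _))//.
  by rewrite mulrDl mul1r mulrDl lerD// distrC mean_dist.
case: M adm t0 => [_ _|_ t0|o /= o1].
- rewrite term_mean_std -[X in _ - X](avg_cst N_gt0) -avgB.
  by apply: ler_norm_avg => // p; exact: cell_dist.
- have k0 : (0 < multideg j)%N.
    by rewrite lt0n; apply: contraNneq t0 => /mixed_deg0->.
  rewrite term_mean_mixedE; apply: mixed_mean_dist => // [xj p|p].
    rewrite cell_uniformD monom_ratio_gt0//.
    by rewrite (le_trans (ler_norm_cell _ _)).
  exact: cell_dist.
- by rewrite term_mean_noncomm// eqxx.
Qed.

Lemma term_mean_quadratic (M : peds_map R m) (a : multidx m -> R) j :
  admissible M a x -> a j != 0 -> exists2 C, 0 <= C & forall h, `|h| <= eta ->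
  `|term_mean M (X + h) j - monom (mean_state (X + h)) j| <= C * `|h| ^+ 2.
Proof.
move=> adm aj; have [C1 C10 hC1] := avg_monom_quadratic j.
suff [C C0 hC] : exists2 C, 0 <= C & forall h, `|h| <= eta ->
    term_mean M (X + h) j = monom (mean_state (X + h)) j \/
    `|term_mean M (X + h) j - avg (fun p : 'I_N => monom (cell (X + h) p) j)|
      <= C * `|h| ^+ 2.
  exists (C + C1) => [|h he]; first exact: addr_ge0.
  have [->|th] := hC h he.
    by rewrite subrr normr0 mulr_ge0 ?addr_ge0.
  rewrite -(subrKA (avg (fun p : 'I_N => monom (cell (X + h) p) j))).
  by rewrite (le_trans (ler_normD _ _))// mulrDl lerD// hC1.
case: M adm => [_|adm|o o1].
- by exists 0 => // h _; right; rewrite term_mean_std subrr normr0 mul0r.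
- have [k0|k0] := posnP (multideg j).
    by exists 0 => // h _; left; exact: mixed_deg0.
  have [xj|xj] := eqVneq (monom x j) 0; last first.
    have B0 : 0 <= Lip j * eta by rewrite mulr_ge0 ?monom_lipschitz_ge0// ltW.
    have [C C0 hC] := mixed_mean_quadratic N_gt0 k0 xj B0.
    exists (C * Lip j ^+ 2) => [|h he].
      by rewrite mulr_ge0// exprn_ge0// monom_lipschitz_ge0.
    right; rewrite -mulrA -exprMn term_mean_mixedE; apply: hC => [|p|p].
    + by rewrite ler_wpM2l// monom_lipschitz_ge0.
    + rewrite cell_uniformD monom_ratio_gt0//.
      by rewrite (le_trans (ler_norm_cell _ _)).
    + exact: cell_dist.
  (* In degree 1 the mixed mean is the plain average. In higher degree with [monom x j = 0],
     admissibility makes the vanishing exponents total at least 2, so both means are separately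
     quadratic. *)
  have [k1|k2] := leqP 2 (multideg j); last first.
    have k1 : multideg j = 1%N by apply/eqP; rewrite eqn_leq k0 -ltnS k2.
    exists 0 => // h _; right; rewrite term_mean_mixedE /mixed_mean k1 expr1.
    rewrite (_ : \sum_p _ = (avg (fun p : 'I_N => monom (cell (X + h) p) j))%:C).
      by rewrite subrr normr0 mul0r.
    rewrite /avg mulr_sumr -[RHS]/(real_complex R _) rmorph_sum.
    by apply: eq_bigr => p _; rewrite kroot1 rmorphM.
  have zn0 : (\sum_(l < m | x 0%R l == 0%R) j l)%N != 0%N.
    apply: contra_eqN xj; rewrite sum_nat_eq0 => /forall_inP jx.
    by rewrite prodf_seq_neq0; apply/allP => l _ /=; rewrite expf_eq0 negb_and
      -leqNgt leqn0 orbC -implybE; apply/implyP => /jx.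
  have z2 : (2 <= \sum_(l < m | x 0%R l == 0%R) j l)%N.
    have := adm j aj k1; move: zn0; by case: (\sum_(_ < _ | _) _)%N => [|[|]].
  have [C C0 hC] := monom_vanishing_quadratic z2.
  have hp h p : `|h| <= eta -> `|monom (cell (X + h) p) j| <= C * `|h| ^+ 2.
    move=> he; have ch := ler_norm_cell h p; rewrite cell_uniformD.
    rewrite (le_trans (hC _ (le_trans ch he)))// ler_wpM2l//.
    by rewrite lerXn2r ?nnegrE.
  exists (C + C) => [|h he]; first exact: addr_ge0.
  right; rewrite mulrDl (le_trans (ler_normB _ _))// lerD//.
    by rewrite term_mean_mixedE; apply: ler_norm_mixed_mean => // p; exact: hp.
  by apply: ler_norm_avg => // p; exact: hp.
- by exists 0 => // h _; left; exact: term_mean_noncomm.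
Qed.

End Estimates.

(** * The extended system *)

Lemma exists_taylor_radius (R : realType) m (x : 'rV[R]_m) (r : 'I_m -> R) :
  (forall l, `|x 0 l| < r l) ->
  exists eta, [/\ 0 < eta, eta <= 1,
    forall l, (1 + eta) * radius x eta 0 l < r l &
    forall l, x 0 l != 0 -> eta < `|x 0 l|].
Proof.
(* For [eta <= 1], [(1 + eta) * (|x 0 l| + eta)] is at most [|x 0 l| + eta * (2 + |x 0 l|)]; [e1]
   keeps the increment to half of the gap to [r l]. *)
move=> xr; pose e1 l := (r l - `|x 0 l|) / (2 * (2 + `|x 0 l|)).
pose e2 l := if x 0 l == 0 then 1 else `|x 0 l| / 2.
pose eta := \big[Num.min/1]_l Num.min (e1 l) (e2 l).
have den l : 0 < 2 * (2 + `|x 0 l|) by rewrite mulr_gt0// ltr_wpDr.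
have e_gt0 : 0 < eta.
  rewrite /eta; apply: lt_bigmin => // l _; rewrite lt_min divr_gt0 ?subr_gt0//=.
  by rewrite /e2; case: eqVneq => // x0; rewrite divr_gt0 ?normr_gt0.
have el l : eta <= Num.min (e1 l) (e2 l) by apply: bigmin_le.
have e1' : eta <= 1 by apply: bigmin_le_id.
exists eta; split=> // l.
  rewrite mxE; have := el l; rewrite le_min => /andP[+ _].
  rewrite ler_pdivlMr// => h; have := xr l.
  have : eta * eta <= eta by rewrite ler_piMr// ltW.
  by nra.
move=> x0; have := el l; rewrite le_min /e2 (negPf x0).
move=> /andP[_ /le_lt_trans]; apply.
by rewrite ltr_pdivrMr// ltr_pMr ?normr_gt0// ltr1n.
Qed.

Lemma littleo_at0_eq0 (R : realType) (V : normedModType R) (e : V -> R) :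
  littleo_at0 e -> e 0 = 0.
Proof.
move=> /(_ _ ltr01)[d d0 /(_ 0)]; rewrite normr0 mulr0 => /(_ (ltW d0)).
by rewrite normr_le0 => /eqP.
Qed.

Section ExtendedSystem.
Variables (R : realType) (m N : nat) (f : 'rV[R]_m -> 'rV[R]_m)
  (a : 'I_m -> multidx m -> R) (r : 'I_m -> R) (x : 'rV[R]_m).
Hypotheses (N_gt0 : (0 < N)%N)
  (hf : forall i, taylor_on r (fun y => f y 0 i) (a i))
  (hx : forall l, `|x 0 l| < r l).
Local Notation X := (uniform_state N x).

Lemma taylor_jacobian : differentiable f x /\
  forall i, littleo_at0 (fun u => f (x + u) 0 i - f x 0 i - (Jac f x *m u^T) i 0).
Proof.
have [eta [e0 e1 er ex]] := exists_taylor_radius hx.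
have /choice[D hD] i := taylor_differential e0 er (hf i).
pose A : 'M[R]_m := \matrix_(l, i) D i l 0.
have uA (u : 'rV[R]_m) i : (u *m A) 0 i = (u *m D i) 0 0.
  by rewrite !mxE; apply: eq_bigr => l _; rewrite mxE.
have [|df JE] := @differentiable_rV _ _ _ f x A.
  move=> i; have := hD i; congr littleo_at0; apply/funext => u.
  by rewrite -uA !mxE.
split=> // i; rewrite JE; have := hD i; congr littleo_at0; apply/funext => u.
by rewrite -trmx_mul -uA [(_^T) i 0]mxE.
Qed.

(** Expanding [f] at the averaged state turns the difference into one series of terms
    [term_mean - monom], to which dominated differentiation applies. *)
Lemma avg_Fmx_littleo i (M : peds_map R m) : admissible M (a i) x ->
  littleo_at0 (fun h : 'rV[R]_(m * N) =>
    avg (fun p => \sum_q Fmx (a i) M (X + h) p q) - f (x + mean_state h) 0 i).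
Proof.
move=> adm; have [eta [e0 e1 er ex]] := exists_taylor_radius hx.
apply: (@littleo_homsum _ _ x eta e0 r (fun y => f y 0 i) (a i) er (hf i) _ 2
  (fun j h => term_mean M (X + h) j - monom (mean_state (X + h)) j)) => //.
- move=> j h he; rewrite normrM.
  have -> : 2 * (`|a i j| * monom_lipschitz x eta j) * `|h| =
    `|a i j| * (2 * monom_lipschitz x eta j * `|h|) by ring.
  by rewrite ler_wpM2l// (term_mean_dist N_gt0 e0 ex _ adm he).
- move=> j; have [aj|aj] := eqVneq (a i j) 0.
    by exists 0 => // h _; rewrite aj !mul0r normr0.
  have [C C0 hC] := term_mean_quadratic N_gt0 e0 e1 ex adm aj.
  exists (`|a i j| * C) => [|h he]; first exact: mulr_ge0.
  by rewrite normrM -mulrA ler_wpM2l// hC.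
move=> h he; have mh := le_trans (ler_norm_mean N_gt0 h) he.
have [_ cf] := hf i (fun l => near_radius e0 er l mh).
have cS :
    series (fun k => homsum k (fun j => a i j * term_mean M (X + h) j)) @ \oo -->
    avg (fun p => \sum_q Fmx (a i) M (X + h) p q).
  have cr := cvg_radius_series e0 er (hf i).
  apply: (@cvg_term_mean _ _ _ N_gt0 (a i) M (X + h) (radius x eta) cr) => l p.
  rewrite !mxE mxtens_indexK (le_trans (ler_normD _ _))// lerD2l.
  exact: le_trans (ler_rV_norm _ _) he.
have -> : (fun k => homsum k (fun j => a i j *
      (term_mean M (X + h) j - monom (mean_state (X + h)) j))) =
    (fun k => homsum k (fun j => a i j * term_mean M (X + h) j))
    - (fun k => homsum k (fun j => a i j * monom (x + mean_state h) j)).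
  apply/funext => k; rewrite !fctE -homsumB; apply: eq_homsum => j _.
  by rewrite mulrBr mean_uniformD.
by rewrite seriesD seriesN; exact: cvgB cS cf.
Qed.

Lemma ext_fieldE (alpha : 'rV[R]_m) (M : 'I_m -> peds_map R m)
    (v : 'rV[R]_(m * N)) i p :
  ext_field a alpha M v 0 (mxtens_index (i, p)) =
  avg (fun p => \sum_q Fmx (a i) (M i) v p q)
  - alpha 0 i * (v 0 (mxtens_index (i, p)) - mean_state v 0 i).
Proof.
rewrite mxE mxtens_indexK mxE Omega1_mean; congr (_ + _).
rewrite mulmxBl mul1mx !mxE; congr (- (_ * (_ - _))).
by rewrite /avg mulr_sumr; apply: eq_bigr => q _; rewrite !mxE.
Qed.

(** [Omega1] averages each block: [diag_mx alpha] contributes the mean and [Dmx] the entry itself,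
    which together form the decay term. *)
Lemma ext_jacobian_mul (J : 'M[R]_m) (alpha : 'rV[R]_m) (h : 'rV[R]_(m * N)) i p :
  (h *m ((J + diag_mx alpha) *t Omega1 R N - Dmx N alpha)^T)
    0 (mxtens_index (i, p)) =
  (J *m (mean_state h)^T) i 0
  - alpha 0 i * (h 0 (mxtens_index (i, p)) - mean_state h 0 i).
Proof.
set s := mxtens_index (i, p).
rewrite linearB /= mulmxBr mxE [X in _ + X]mxE.
have -> : (h *m (Dmx N alpha)^T) 0 s = h 0 s * alpha 0 i.
  by rewrite tr_diag_mx mul_mx_diag !mxE mxtens_indexK.
have -> : (h *m ((J + diag_mx alpha) *t Omega1 R N)^T) 0 s =
    ((J + diag_mx alpha) *m (mean_state h)^T) i 0.
  rewrite [LHS]mxE [RHS]mxE (reindex (@mxtens_index m N)) /=; last first.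
    by exists (@mxtens_unindex m N) => k _; rewrite ?mxtens_indexK ?mxtens_unindexK.
  transitivity (\sum_l \sum_(q < N)
      h 0 (mxtens_index (l, q)) * ((J + diag_mx alpha) i l * N%:R^-1)).
    rewrite pair_big; apply: eq_bigr => -[l q] _ /=.
    by rewrite [(_^T) _ _]mxE tensmxE; congr (_ * (_ * _)); rewrite mxE.
  apply: eq_bigr => l _; rewrite -mulr_suml [(_^T) _ _]mxE.
  by rewrite [X in _ = _ * X]mxE /avg mulrC mulrA.
rewrite mulmxDl mul_diag_mx !mxE; ring.
Qed.

Hypothesis hfx : f x = 0.

Lemma ext_field_differential (alpha : 'rV[R]_m) (M : 'I_m -> peds_map R m) :
  (forall i, admissible (M i) (a i) x) ->
  [/\ ext_field a alpha M X = 0, differentiable (ext_field a alpha M) X &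
      Jac (ext_field a alpha M) X =
        (Jac f x + diag_mx alpha) *t Omega1 R N - Dmx N alpha].
Proof.
move=> adm; set G := ext_field a alpha M.
have XE i p : X 0 (mxtens_index (i, p)) = x 0 i by rewrite mxE mxtens_indexK.
have mX : mean_state X = x.
  by apply/rowP => i; rewrite mxE; under eq_fun do rewrite XE; rewrite avg_cst.
have mean0 : mean_state (0 : 'rV[R]_(m * N)) = 0.
  by apply/rowP => i; rewrite !mxE; under eq_fun do rewrite mxE; rewrite avg_cst.
have GX : G X = 0.
  apply/rowP => s; case: (mxtens_indexP s) => i p.
  rewrite ext_fieldE XE mX subrr mulr0 subr0 [RHS]mxE.
  (* A little-o vanishes at 0, so the averaged field at [X] equals [f x], which is 0. *)
  have := littleo_at0_eq0 (avg_Fmx_littleo (adm i)).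
  by rewrite !addr0 mean0 addr0 hfx mxE subr0.
have [_ fo] := taylor_jacobian.
have [|dG JE] := @differentiable_rV _ _ _ G X
    ((Jac f x + diag_mx alpha) *t Omega1 R N - Dmx N alpha)^T.
  move=> s; case: (mxtens_indexP s) => i p.
  (* The remainder splits into the passage from the averaged field to [f], and the remainder of [f]
     along the norm-decreasing map [mean_state]; the decay is linear and cancels exactly. *)
  have := littleo_at0D (avg_Fmx_littleo (adm i))
    (littleo_at0_comp (@ler_norm_mean _ m _ N_gt0) (fo i)).
  congr littleo_at0; apply/funext => h.
  rewrite GX subr0 [RHS]mxE [X in _ = _ + X]mxE ext_jacobian_mul ext_fieldE.
  rewrite mean_uniformD// hfx !mxE mxtens_indexK /=; ring.
by split=> //; rewrite JE trmxK.
Qed.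

End ExtendedSystem.

Lemma Dmx_const (R : realType) m N (al : R) :
  Dmx N (const_mx al : 'rV_m) = al%:M.
Proof.
rewrite /Dmx -diag_const_mx; congr diag_mx.
by apply/rowP => s; rewrite !mxE.
Qed.

Unset Implicit Arguments.

Theorem mainTheorem10 (R : realType) (m N : nat)
    (f : 'rV[R]_m -> 'rV[R]_m) (a : 'I_m -> multidx m -> R)
    (r : 'I_m -> R) (x : 'rV[R]_m) (lam : 'I_m -> R[i])
    (hm : (0 < m)%N) (hN : (0 < N)%N)
    (hf : forall i, taylor_on r (fun y => f y 0 i) (a i))
    (hx : forall l, `|x 0 l| < r l)
    (hfx : f x = 0)
    (hlam : has_spectrum (Jac f x) [seq lam i | i : 'I_m]) :
  (* the Jacobian of the extended system *)
  (forall (alpha : 'rV[R]_m) (M : 'I_m -> peds_map R m),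
      (forall i, 0 < alpha 0 i) ->
      (forall i, admissible (M i) (a i) x) ->
      let G := @ext_field R m N a alpha M in
      let X := uniform_state N x in
      [/\ G X = 0,
          differentiable G X &
          Jac G X = (Jac f x + diag_mx alpha) *t Omega1 R N - Dmx N alpha]) /\
  (* constant alpha, general projector *)
  (forall (al : R) (k : nat) (Omega : 'M[R]_N),
      0 < al ->
      Omega *m Omega = Omega ->
      has_spectrum Omega (nseq k 1 ++ nseq (N - k) 0) ->
      let J := (Jac f x + al%:M) *t Omega - al%:M in
      [/\ has_spectrum J (flatten [seq nseq k (lam i) | i : 'I_m]
                            ++ nseq (m * (N - k)) (- al)%:C),
          (forall i, complex.Re (lam i) < 0) -> stable_mx J,
          (0 < k < N)%N -> (forall i, 0 < complex.Re (lam i)) ->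
            [/\ saddle_mx J,
                eigenvalue_count J (@negRe R) (m * (N - k)) &
                eigenvalue_count J (@posRe R) (m * k)],
          (0 < k < N)%N -> (exists i, 0 < complex.Re (lam i)) ->
            [/\ saddle_mx J,
                eigenvalue_count J (@negRe R)
                  (m * (N - k) + k * #|[pred i | negRe (lam i)]|) &
                eigenvalue_count J (@posRe R)
                  (k * #|[pred i | posRe (lam i)]|)] &
          [/\ stable_mx (Jac f x) -> stable_mx J,
              (0 < k)%N -> saddle_mx (Jac f x) -> saddle_mx J &
              (0 < k < N)%N -> unstable_mx (Jac f x) -> saddle_mx J]]) /\
  (* Omega1 is a projector with k = 1 *)
  (Omega1 R N *m Omega1 R N = Omega1 R N /\
   has_spectrum (Omega1 R N) (nseq 1 1 ++ nseq (N - 1) 0)) /\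
  (* constant alpha, extended system *)
  (forall (al : R) (M : 'I_m -> peds_map R m),
      0 < al ->
      (forall i, admissible (M i) (a i) x) ->
      let G := @ext_field R m N a (const_mx al) M in
      let X := uniform_state N x in
      [/\ stable_eq f x -> stable_eq G X,
          saddle_eq f x -> saddle_eq G X &
          (1 < N)%N -> unstable_eq f x -> saddle_eq G X]).
Proof.
have O1 := Omega1_spectrum R hN.
split; first by move=> alpha M _ adm; exact: (ext_field_differential hN hf hx hfx).
split.
  move=> al k Omega al0 _ Ok; have sad := saddle_tens_pos al0 hlam Ok.
  split.
  - exact: tens_shift_spectrum.
  - exact: (stable_tens_spectrum al0 hlam Ok).
  - move=> kN lp; have [cn cp] := count_tens_unstable al0 hlam Ok lp.
    by split=> //; apply: sad => //; exists (Ordinal hm); exact: lp.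
  - move=> kN lp; split; first exact: sad.
      exact: (count_negRe_tens al0 hlam Ok).
    exact: (count_posRe_tens al0 hlam Ok).
  - split.
    + exact: (stable_tens al0 hlam Ok).
    + exact: (saddle_tens al hlam Ok).
    + exact: (saddle_tens_unstable al0 hlam Ok hm).
split; first by split=> //; exact: Omega1_idem.
move=> al M al0 adm G X.
have [GX _ JG] := ext_field_differential hN hf hx hfx (const_mx al) adm.
(* For constant decay rates both diagonal matrices are scalar, and the spectral results apply to
   [Omega1] with [k = 1]. *)
have {}JG : Jac G X = (Jac f x + al%:M) *t Omega1 R N - al%:M.
  by rewrite JG Dmx_const diag_const_mx.
split=> [[_ st]|[_ sd]|N1 [_ un]]; split=> //; rewrite JG.
- exact: (stable_tens al0 hlam O1).
- exact: (saddle_tens al hlam O1).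
- exact: (saddle_tens_unstable al0 hlam O1 hm).
Qed.
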